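(* Let $\Bbbk$ be a field of characteristic $p>2$, let $m,n\in\mathbb N$ and let $r\ge1$ be an integer. Then: (i) $\dim_{\Bbbk}\Sigma^{(r)}_{m|n}=\dim_{\mathbb C}\mathrm{End}_{GL(m|n)}(V_{m|n,\mathbb C}^{\otimes r})$. (ii) The inclusion $\Sigma^{(r)}_{m|n,\mathbb Z}\subseteq \mathrm{End}(V_{m|n,\mathbb Z}^{\otimes r})$ induces an injective algebra morphism $$\widetilde\Phi^{(r)}_{m|n}:\Sigma^{(r)}_{m|n}\hookrightarrow \mathrm{End}_{GL(m|n)}(V_{m|n}^{\otimes r})$$ whose composition with the algebra morphism $\Bbbk S_r\to\Sigma^{(r)}_{m|n}$ (induced by $f:\mathbb ZS_r\to\Sigma^{(r)}_{m|n,\mathbb Z}$) is $\Phi^{(r)}_{m|n}$. (iii) The morphism $\widetilde\Phi^{(r)}_{m|n}$ is an isomorphism if and only if $$\dim_{\Bbbk}\mathrm{End}_{GL(m|n)}(V_{m|n}^{\otimes r})=\dim_{\mathbb C}\mathrm{End}_{GL(m|n)}(V_{m|n,\mathbb C}^{\otimes r}).$$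
   Context: $\mathbb N=\{0,1,2,\dots\}$. For a commutative ring $K$ among $\Bbbk,\mathbb C,\mathbb Z$ let $V_{m|n,K}=K^{m|n}$ be the free super module with even part of rank $m$ and odd part of rank $n$; $V_{m|n}=V_{m|n,\Bbbk}$. For $K$ a field ($\Bbbk$ or $\mathbb C$), $GL(m|n)$ is the affine group superscheme over $K$ sending a supercommutative $K$-superalgebra $R$ to the group of parity-preserving $R$-linear automorphisms of $V_{m|n,K}\otimes R$; it acts diagonally on $V_{m|n,K}^{\otimes r}$, and $\mathrm{End}_{GL(m|n)}(V_{m|n,K}^{\otimes r})$ is the algebra of (parity-preserving) $K$-linear endomorphisms commuting with this action. Over each $K$, $S_r$ acts on $V_{m|n,K}^{\otimes r}$ by $$\sigma(v_1\otimes\cdots\otimes v_r)=(-1)^{\langle\sigma;v_1,\dots,v_r\rangle}\,v_{\sigma^{-1}1}\otimes\cdots\otimes v_{\sigma^{-1}r}$$ for homogeneous $v_i$, where $\langle\sigma;v_1,\dots,v_r\rangle=\#\{1\le k<l\le r\mid \sigma k>\sigma l,\ v_k,v_l \text{ odd}\}$. Over $\Bbbk$ this commutes with $GL(m|n)$ and gives the algebra morphism $\Phi^{(r)}_{m|n}:\Bbbk S_r\to\mathrm{End}_{GL(m|n)}(V_{m|n}^{\otimes r})$; over $\mathbb Z$ it gives a ring homomorphism $f:\mathbb ZS_r\to\mathrm{End}(V_{m|n,\mathbb Z}^{\otimes r})$. Define $$\Sigma^{(r)}_{m|n,\mathbb Z}:=\mathrm{im}\big(\mathbb Z[1/p]\otimes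 f\big)\cap \mathrm{End}(V_{m|n,\mathbb Z}^{\otimes r})=\{x\in \mathrm{End}(V_{m|n,\mathbb Z}^{\otimes r})\mid p^ix\in\mathrm{im} f\text{ for some }i\in\mathbb N\},$$ a subring of $\mathrm{End}(V_{m|n,\mathbb Z}^{\otimes r})$ containing $\mathrm{im} f$, and let $\Sigma^{(r)}_{m|n}:=\Bbbk\otimes_{\mathbb Z}\Sigma^{(r)}_{m|n,\mathbb Z}$. *)

(* Defs.v *)
From HB Require Import structures.
From mathcomp Require Import all_boot all_order all_fingroup all_algebra.
From mathcomp Require Import generic_quotient boolp reals complex zify.

Set Implicit Arguments.
Unset Strict Implicit.
Unset Printing Implicit Defensive.

Import GRing.Theory.
Local Open Scope ring_scope.
Local Open Scope quotient_scope.

Section Dimension.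
Variables (K : fieldType) (V : lmodType K).

Definition is_basis (d : nat) (b : 'I_d -> V) : Prop :=
  forall v : V, exists! c : {ffun 'I_d -> K}, v = \sum_i c i *: b i.

Definition has_dim (d : nat) : Prop := exists b : 'I_d -> V, is_basis b.
End Dimension.

Section ScalarExtension.
Variables (K : comNzRingType) (M : zmodType).

Definition biadditive (B : zmodType) (h : K -> M -> B) : Prop :=
  (forall a a' x, h (a + a') x = h a x + h a' x) /\
  (forall a x x', h a (x + x') = h a x + h a x').

Definition tens_eval (B : zmodType) (h : K -> M -> B) (s : seq (K * M)) : B :=
  \sum_(u <- s) h u.1 u.2.

(* K (x)_Z M is built as formal finite sums of pairs a (x) x, two sums being
   identified when every biadditive map to an abelian group takes the same value
   on both.  [tens_lift], [tens_lift_tens] and [tensE] give its universal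
   property: a biadditive map factors through [tens], uniquely since the a (x) x
   generate. *)
Definition tens_eq (s t : seq (K * M)) : bool :=
  `[< forall (B : zmodType) (h : K -> M -> B), biadditive h ->
        tens_eval h s = tens_eval h t >].

Lemma tens_eq_refl : reflexive tens_eq.
Proof. by move=> s; apply/asboolP. Qed.

Lemma tens_eq_sym : symmetric tens_eq.
Proof.
by move=> s t; apply/asboolP/asboolP => h B b bb; rewrite h.
Qed.

Lemma tens_eq_trans : transitive tens_eq.
Proof.
move=> t s u /asboolP h1 /asboolP h2; apply/asboolP => B b bb.
by rewrite h1 // h2.
Qed.

Canonical tens_equiv := EquivRel tens_eq tens_eq_refl tens_eq_sym tens_eq_trans.

Definition tensor := {eq_quot tens_equiv}.
HB.instance Definition _ := Choice.on tensor.
HB.instance Definition _ := EqQuotient.on tensor.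

Definition tens (a : K) (x : M) : tensor := \pi_tensor [:: (a, x)].

Definition tens_lift (B : zmodType) (h : K -> M -> B) (x : tensor) : B :=
  tens_eval h (repr x).

Lemma tens_lift_pi (B : zmodType) (h : K -> M -> B) s :
  biadditive h -> tens_lift h (\pi_tensor s) = tens_eval h s.
Proof.
move=> hh; rewrite /tens_lift.
have /eqquotP/asboolP : repr (\pi_tensor s) = s %[mod tensor] by rewrite reprK.
by apply.
Qed.

Lemma tensorP (x y : tensor) :
  (forall (B : zmodType) (h : K -> M -> B), biadditive h ->
     tens_lift h x = tens_lift h y) -> x = y.
Proof.
move=> hxy; rewrite -[x]reprK -[y]reprK; apply/eqquotP/asboolP => B h hh.
exact: hxy.
Qed.

Definition tens0 : tensor := \pi_tensor [::].
Definition tensD (x y : tensor) : tensor := \pi_tensor (repr x ++ repr y).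
Definition tensN (x : tensor) : tensor :=
  \pi_tensor [seq (- u.1, u.2) | u <- repr x].
Definition tensZ (c : K) (x : tensor) : tensor :=
  \pi_tensor [seq (c * u.1, u.2) | u <- repr x].

Section Eval.
Variables (B : zmodType) (h : K -> M -> B) (hh : biadditive h).

Lemma biadditive0l x : h 0 x = 0.
Proof. by apply: (@addrI _ (h 0 x)); rewrite -hh.1 !addr0. Qed.

Lemma biadditiveNl a x : h (- a) x = - h a x.
Proof. by apply: (@addrI _ (h a x)); rewrite -hh.1 !subrr biadditive0l. Qed.

Lemma biadditiveZ c : biadditive (fun a => h (c * a)).
Proof. by split=> *; rewrite ?mulrDr (hh.1, hh.2). Qed.

Lemma tens_lift0 : tens_lift h tens0 = 0.
Proof. by rewrite tens_lift_pi // /tens_eval big_nil. Qed.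

Lemma tens_liftD x y : tens_lift h (tensD x y) = tens_lift h x + tens_lift h y.
Proof. by rewrite tens_lift_pi // /tens_eval big_cat. Qed.

Lemma tens_liftN x : tens_lift h (tensN x) = - tens_lift h x.
Proof.
rewrite tens_lift_pi // /tens_eval big_map /= -sumrN.
by apply: eq_bigr => u _; rewrite biadditiveNl.
Qed.

Lemma tens_liftZ c x :
  tens_lift h (tensZ c x) = tens_lift (fun a => h (c * a)) x.
Proof. by rewrite tens_lift_pi // /tens_eval big_map. Qed.

Lemma tens_lift_tens a x : tens_lift h (tens a x) = h a x.
Proof. by rewrite tens_lift_pi // /tens_eval big_seq1. Qed.
End Eval.

Lemma eq_tens_lift (B : zmodType) (h h' : K -> M -> B) x :
  (forall a m, h a m = h' a m) -> tens_lift h x = tens_lift h' x.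
Proof. by move=> e; apply: eq_bigr. Qed.

Lemma tens_lift_add (B : zmodType) (h h' : K -> M -> B) x :
  tens_lift (fun a m => h a m + h' a m) x = tens_lift h x + tens_lift h' x.
Proof. exact: big_split. Qed.

Fact tensDA : associative tensD.
Proof. by move=> x y z; apply: tensorP => B h hh; rewrite !tens_liftD // addrA. Qed.
Fact tensDC : commutative tensD.
Proof. by move=> x y; apply: tensorP => B h hh; rewrite !tens_liftD // addrC. Qed.
Fact tens0D : left_id tens0 tensD.
Proof.
by move=> x; apply: tensorP => B h hh; rewrite tens_liftD // tens_lift0 // add0r.
Qed.
Fact tensND : left_inverse tens0 tensN tensD.
Proof.
move=> x; apply: tensorP => B h hh.
by rewrite tens_liftD // tens_liftN // tens_lift0 // addNr.
Qed.
HB.instance Definition _ :=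
  GRing.isZmodule.Build tensor tensDA tensDC tens0D tensND.

Fact tensZA a b x : tensZ a (tensZ b x) = tensZ (a * b) x.
Proof.
apply: tensorP => B h hh; rewrite !tens_liftZ //; last exact: biadditiveZ.
by apply: eq_tens_lift => c m; rewrite mulrA.
Qed.
Fact tens1Z : left_id 1 tensZ.
Proof.
move=> x; apply: tensorP => B h hh; rewrite tens_liftZ //.
by apply: eq_tens_lift => c m; rewrite mul1r.
Qed.
Fact tensZDr : right_distributive tensZ +%R.
Proof.
move=> c x y; apply: tensorP => B h hh.
by rewrite tens_liftZ // !tens_liftD ?tens_liftZ //; apply: biadditiveZ.
Qed.
Fact tensZDl x : {morph tensZ^~ x : a b / a + b}.
Proof.
move=> a b /=; apply: tensorP => B h hh.
rewrite tens_liftD // !tens_liftZ // -tens_lift_add.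
by apply: eq_tens_lift => c m; rewrite mulrDl hh.1.
Qed.
HB.instance Definition _ :=
  GRing.Zmodule_isLmodule.Build K tensor tensZA tens1Z tensZDr tensZDl.

Lemma tens_biadditive : biadditive tens.
Proof.
split=> *; apply: tensorP => B h hh; rewrite tens_liftD // !tens_lift_tens //.
  by rewrite hh.1.
by rewrite hh.2.
Qed.

Lemma tensE (x : tensor) : x = \sum_(u <- repr x) tens u.1 u.2.
Proof.
apply: tensorP => B h hh; rewrite (big_morph _ (tens_liftD hh) (tens_lift0 hh)).
by apply: eq_bigr => u _; rewrite tens_lift_tens.
Qed.

Lemma scale_tens c a x : c *: tens a x = tens (c * a) x.
Proof.
apply: tensorP => B h hh; rewrite tens_liftZ // !tens_lift_tens //.
exact: biadditiveZ.
Qed.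
End ScalarExtension.

Section ScalarExtensionRing.
Variables (K : comNzRingType) (M : pzRingType).
Local Notation T := (tensor K M).
Implicit Types x y z : T.

Definition tensM x y : T :=
  \pi_T [seq (u.1 * v.1, u.2 * v.2) | u <- repr x, v <- repr y].

Lemma biadditiveMl (B : zmodType) (h : K -> M -> B) b n :
  biadditive h -> biadditive (fun a m => h (a * b) (m * n)).
Proof. by move=> hh; split=> *; rewrite mulrDl (hh.1, hh.2). Qed.

Lemma biadditiveMr (B : zmodType) (h : K -> M -> B) a m :
  biadditive h -> biadditive (fun b n => h (a * b) (m * n)).
Proof. by move=> hh; split=> *; rewrite mulrDr (hh.1, hh.2). Qed.

Lemma tens_liftM (B : zmodType) (h : K -> M -> B) x y : biadditive h ->
  tens_lift h (tensM x y) =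
  tens_lift (fun a m => tens_lift (fun b n => h (a * b) (m * n)) y) x.
Proof.
move=> hh; rewrite tens_lift_pi // /tens_eval big_flatten big_map.
by apply: eq_bigr => u _; rewrite big_map.
Qed.

Lemma biadditive_lift (B : zmodType) (h : K -> M -> B) y : biadditive h ->
  biadditive (fun a m => tens_lift (fun b n => h (a * b) (m * n)) y).
Proof.
by move=> hh; split=> *; rewrite -tens_lift_add; apply: eq_tens_lift => b n;
  rewrite mulrDl (hh.1, hh.2).
Qed.

Fact tensMA : associative tensM.
Proof.
move=> x y z; apply: tensorP => B h hh.
rewrite !tens_liftM //; last exact: biadditive_lift.
apply: eq_tens_lift => a m; rewrite tens_liftM; last exact: biadditiveMr.
apply: eq_tens_lift => b n; apply: eq_tens_lift => c q.
by rewrite !mulrA.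
Qed.

Fact tens1M : left_id (tens 1 1) tensM.
Proof.
move=> x; apply: tensorP => B h hh.
rewrite tens_liftM // tens_lift_tens; last exact: biadditive_lift.
by apply: eq_tens_lift => a m; rewrite !mul1r.
Qed.

Fact tensM1 : right_id (tens 1 1) tensM.
Proof.
move=> x; apply: tensorP => B h hh; rewrite tens_liftM //.
apply: eq_tens_lift => a m; rewrite tens_lift_tens; last exact: biadditiveMr.
by rewrite !mulr1.
Qed.

Fact tensMDl : left_distributive tensM +%R.
Proof.
move=> x y z; apply: tensorP => B h hh.
rewrite tens_liftM // !tens_liftD ?tens_liftM //; exact: biadditive_lift.
Qed.

Fact tensMDr : right_distributive tensM +%R.
Proof.
move=> x y z; apply: tensorP => B h hh.
rewrite tens_liftM // !tens_liftD ?tens_liftM // -tens_lift_add.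
apply: eq_tens_lift => a m; rewrite tens_liftD //; exact: biadditiveMr.
Qed.

HB.instance Definition _ :=
  GRing.Zmodule_isPzRing.Build T tensMA tens1M tensM1 tensMDl tensMDr.

Lemma mul_tens a b (m n : M) : tens a m * tens b n = tens (a * b) (m * n) :> T.
Proof.
apply: tensorP => B h hh.
by rewrite tens_liftM // !tens_lift_tens //; [exact: biadditiveMr|exact: biadditive_lift].
Qed.
End ScalarExtensionRing.

Section GroupAlgebra.
Variables (K : comNzRingType) (r : nat).

(* The group algebra K S_r for the usual composition of permutations, applied
   from right to left.  The library product is in the opposite order:
   (t * s)%g is s o t, hence the argument (u * s^-1)%g = s^-1 o u below. *)
Definition galg : Type := {ffun 'S_r -> K}.
HB.instance Definition _ := GRing.Lmodule.copy galg {ffun 'S_r -> K^o}.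

Definition galg1 : galg := [ffun s => (s == 1%g)%:R].

Definition galgM (x y : galg) : galg :=
  [ffun u => \sum_s x s * y (u * s^-1)%g].

Fact galgMA : associative galgM.
Proof.
move=> x y z; apply/ffunP => u; rewrite !ffunE.
under eq_bigr => s _ do rewrite ffunE big_distrr /=.
under [RHS]eq_bigr => s _ do rewrite ffunE big_distrl /=.
rewrite [RHS]exchange_big /=; apply: eq_bigr => s _.
rewrite [RHS](reindex_inj (mulIg s)) /=; apply: eq_bigr => t _.
by rewrite mulrA mulgK invMg mulgA.
Qed.

Fact galg1M : left_id galg1 galgM.
Proof.
move=> x; apply/ffunP => u; rewrite ffunE (bigD1 1%g) //= big1 ?addr0.
  by rewrite ffunE eqxx mul1r invg1 mulg1.
by move=> s /negbTE s1; rewrite ffunE s1 mul0r.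
Qed.

Fact galgM1 : right_id galg1 galgM.
Proof.
move=> x; apply/ffunP => u; rewrite ffunE (bigD1 u) //= big1 ?addr0.
  by rewrite ffunE mulgV eqxx mulr1.
move=> s su; rewrite ffunE -eq_mulgV1 eq_sym (negbTE su).
by rewrite mulr0.
Qed.

Fact galgMDl : left_distributive galgM +%R.
Proof.
move=> x y z; apply/ffunP => u; rewrite !ffunE -big_split.
by apply: eq_bigr => s _; rewrite !ffunE mulrDl.
Qed.

Fact galgMDr : right_distributive galgM +%R.
Proof.
move=> x y z; apply/ffunP => u; rewrite !ffunE -big_split.
by apply: eq_bigr => s _; rewrite !ffunE mulrDr.
Qed.

HB.instance Definition _ :=
  GRing.Zmodule_isPzRing.Build galg galgMA galg1M galgM1 galgMDl galgMDr.

Section Lift.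
Variables (B : pzRingType) (w : K -> 'S_r -> B).
Hypothesis w_zmod : forall s, zmod_morphism (w^~ s).
Hypothesis w1 : w 1 1%g = 1.
Hypothesis wM : forall a b s t, w a s * w b t = w (a * b) (t * s)%g.

(* Linear extension: w c s stands for c times the image of s. *)
Definition galg_lift (y : galg) : B := \sum_s w (y s) s.

Lemma galg_lift_zmod : zmod_morphism galg_lift.
Proof.
move=> x y; rewrite /galg_lift -sumrB; apply: eq_bigr => s _.
by rewrite -w_zmod !ffunE.
Qed.

Lemma galg_w0 s : w 0 s = 0.
Proof. by rewrite -[in LHS](subrr 0) w_zmod subrr. Qed.

Lemma galg_wD s a b : w (a + b) s = w a s + w b s.
Proof. by rewrite -{1}[b]opprK w_zmod -[- b]add0r w_zmod galg_w0 add0r opprK. Qed.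

Lemma galg_lift_monoid : monoid_morphism galg_lift.
Proof.
split=> [|x y]; rewrite /galg_lift.
  rewrite (bigD1 1%g) //= big1 ?addr0 => [|s /negbTE s1].
    by rewrite ffunE eqxx w1.
  by rewrite ffunE s1 galg_w0.
under eq_bigr => u _ do rewrite ffunE
  (big_morph (w^~ u) (galg_wD u) (galg_w0 u)).
rewrite exchange_big big_distrl /=; apply: eq_bigr => s _.
rewrite big_distrr /= (reindex_inj (mulIg s)); apply: eq_bigr => t _.
by rewrite mulgK wM.
Qed.
End Lift.
End GroupAlgebra.

Section SignLemmas.
Variable r : nat.
Implicit Types (s t : 'S_r) (F : 'I_r -> 'I_r -> bool).

Lemma pairs_reindex s F :
  \big[addb/false]_(kl : 'I_r * 'I_r | (kl.1 < kl.2)%N)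
     F ((s^-1)%g kl.1) ((s^-1)%g kl.2) =
  \big[addb/false]_(kl : 'I_r * 'I_r | (kl.1 < kl.2)%N)
     (if (s kl.1 < s kl.2)%N then F kl.1 kl.2 else F kl.2 kl.1).
Proof.
pose h (kl : 'I_r * 'I_r) := (s kl.1, s kl.2).
pose sw (kl : 'I_r * 'I_r) := (kl.2, kl.1).
have hI : injective h by move=> [a b] [c d] [/perm_inj-> /perm_inj->].
have swI : injective sw by move=> [a b] [c d] [-> ->].
rewrite (reindex_inj hI) /=.
under eq_bigr => kl _ do rewrite !permK.
rewrite (bigID (fun kl : 'I_r * 'I_r => kl.1 < kl.2)%N) /=.
rewrite [RHS](bigID (fun kl : 'I_r * 'I_r => s kl.1 < s kl.2)%N) /=; congr addb.
  by apply: eq_big => [kl|kl /andP[-> _]] //; rewrite andbC.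
rewrite (reindex_inj swI) /=; apply: eq_big => [[k l]|[k l]] /=.
  have e : (s k == s l :> nat) = (k == l :> nat).
    by apply/eqP/eqP => [/val_inj/perm_inj-> //|/val_inj->].
  by case: (ltngtP k l) e => _; case: (ltngtP (s k) (s l)).
by move=> /andP[/ltnW/leq_gtF->].
Qed.

Definition sgnX s (q : 'I_r -> bool) : bool :=
  \big[addb/false]_(kl : 'I_r * 'I_r | (kl.1 < kl.2)%N)
     [&& (s kl.2 < s kl.1)%N, q kl.1 & q kl.2].

Lemma sgnXM s t (q : 'I_r -> bool) :
  sgnX (t * s)%g q = sgnX s (fun k => q ((t^-1)%g k)) (+) sgnX t q.
Proof.
pose F (k l : 'I_r) := [&& (s (t l) < s (t k))%N, q k & q l].
rewrite /sgnX [X in _ = X (+) _](eq_bigr (fun kl => F ((t^-1)%g kl.1) ((t^-1)%g kl.2))); last first.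
  by move=> kl _; rewrite /F !permKV.
rewrite pairs_reindex -big_split /=; apply: eq_bigr => -[k l] /= kl.
rewrite /F !permM andbCA [q l && _]andbC.
case: (q k); case: (q l); rewrite ?andbF ?if_same //= !andbT.
have nst : s (t k) != s (t l) :> nat.
  by apply: contraTneq kl => /val_inj/perm_inj/perm_inj->; rewrite ltnn.
have nt : t k != t l :> nat.
  by apply: contraTneq kl => /val_inj/perm_inj->; rewrite ltnn.
by case: (ltngtP (t k) (t l)) nt => //= _ _; case: ltngtP nst.
Qed.

Lemma sgnX1 q : sgnX 1%g q = false.
Proof. by rewrite /sgnX big1 // => kl lt_kl; rewrite !perm1 ltnNge ltnW. Qed.

Lemma eq_sgnX s (q q' : 'I_r -> bool) : q =1 q' -> sgnX s q = sgnX s q'.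
Proof. by move=> e; apply: eq_bigr => kl _; rewrite !e. Qed.

Lemma sgnX_adj (a b : 'I_r) (q : 'I_r -> bool) :
  b = a.+1 :> nat -> sgnX (tperm a b) q = q a && q b.
Proof.
move=> ab; have neq_ab : b != a by rewrite -val_eqE /= ab neq_ltn ltnSn orbT.
rewrite /sgnX (bigD1 (a, b)) /=; last by rewrite ab.
rewrite tpermL tpermR ab ltnSn /= big1 ?addbF // => -[k l] /= /andP[kl].
rewrite xpair_eqE -!val_eqE /= => nkl.
suff -> : (tperm a b l < tperm a b k)%N = false by [].
move: kl nkl ab; case: tpermP => [->|->|/eqP + /eqP]; case: tpermP => [->|->|/eqP + /eqP];
  rewrite -?val_eqE /=; lia.
Qed.

Lemma perm_adj_ind (P : 'S_r -> Prop) :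
  P 1%g -> (forall s t, P s -> P t -> P (s * t)%g) ->
  (forall a b : 'I_r, b = a.+1 :> nat -> P (tperm a b)) -> forall s, P s.
Proof.
move=> P1 PM Padj.
have Pt : forall d (a b : 'I_r), b = (a + d.+1)%N :> nat -> P (tperm a b).
  elim=> [|d IH] a b ab; first by apply: Padj; rewrite ab addn1.
  have lt_c : (a + d.+1 < r)%N by rewrite (leq_trans _ (ltn_ord b)) // ab; lia.
  pose c := Ordinal lt_c.
  have -> : tperm a b = (tperm c b * tperm a c * tperm c b)%g.
    rewrite -{1}[tperm c b]tpermV -mulgA -[RHS]/(tperm a c ^ tperm c b)%g.
    by rewrite tpermJ tpermL tpermD // -val_eqE /= neq_ltn; lia.
  have Pcb : P (tperm c b) by apply: Padj; rewrite ab /=; lia.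
  by apply: (PM) => //; apply: (PM) => //; exact: IH.
have Pall (a b : 'I_r) : P (tperm a b).
  case: (ltngtP a b) => [ab|ba|/val_inj->]; last by rewrite tperm1.
    by apply: (Pt (b - a).-1); lia.
  by rewrite tpermC; apply: (Pt (a - b).-1); lia.
move=> s; have [ts -> _] := prod_tpermP s.
by elim: ts => [|t ts IH]; rewrite ?big_nil ?big_cons //; apply: (PM).
Qed.

End SignLemmas.

Section SuperTensor.
Variables m n r : nat.

(* K^(m|n) has the basis e_i, i : 'I_(m + n), with e_i even for i < m.  Its r-th
   tensor power has the basis e_i = e_(i 0) (x) ... (x) e_(i (r - 1)) indexed by
   i : mindex, and an endomorphism phi is the matrix acting on columns:
   phi e_j = \sum_i phi_(i,j) e_i, so that matrix product is composition. *)
Definition is_odd (i : 'I_(m + n)) : bool := (m <= i)%N.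

Definition mindex : finType := {ffun 'I_r -> 'I_(m + n)}.

Definition EndV (K : pzRingType) := 'M[K]_#|mindex|.

Definition mxT (K : Type) (F : mindex -> mindex -> K) : 'M[K]_#|mindex| :=
  \matrix_(a, b) F (enum_val a) (enum_val b).

Definition mshift (s : 'S_r) (i : mindex) : mindex := [ffun k => i ((s^-1)%g k)].

Definition sign_exp (s : 'S_r) (i : mindex) : nat :=
  #|[set kl : 'I_r * 'I_r |
      [&& (kl.1 < kl.2)%N, (s kl.2 < s kl.1)%N, is_odd (i kl.1) & is_odd (i kl.2)]]|.

(* s e_j = (-1)^<s; e_j> e_(j o s^-1); the formula for s (v_1 (x) ... (x) v_r) with
   arbitrary homogeneous v_k follows by multilinearity. *)
Definition perm_act (K : pzRingType) (s : 'S_r) : EndV K :=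
  mxT (fun i j => if i == mshift s j then (-1) ^+ sign_exp s j else 0).

Lemma mxT_mul (K : pzRingType) (F G : mindex -> mindex -> K) :
  mxT F *m mxT G = mxT (fun i j => \sum_k F i k * G k j).
Proof.
apply/matrixP => a b; rewrite !mxE [RHS]big_enum_val /=.
by apply: eq_bigr => c _; rewrite !mxE.
Qed.

Lemma eq_mxT (K : Type) (F G : mindex -> mindex -> K) :
  (forall i j, F i j = G i j) -> mxT F = mxT G.
Proof. by move=> e; apply/matrixP => a b; rewrite !mxE. Qed.

Lemma mshiftM s t i : mshift s (mshift t i) = mshift (t * s)%g i.
Proof. by apply/ffunP => k; rewrite !ffunE invMg permM. Qed.

Lemma mshift1 i : mshift 1%g i = i.
Proof. by apply/ffunP => k; rewrite !ffunE invg1 perm1. Qed.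

Lemma mshiftK s : cancel (mshift s) (mshift s^-1%g).
Proof. by move=> i; rewrite mshiftM mulgV mshift1. Qed.

Lemma odd_sign_exp s i :
  odd (sign_exp s i) = sgnX s (fun k => is_odd (i k)).
Proof.
rewrite /sign_exp -sum1_card.
rewrite (big_morph odd oddD (erefl : odd 0 = false)).
rewrite (bigID (fun kl : 'I_r * 'I_r => kl.1 < kl.2)%N) /= addbC big1 /=; last first.
  by move=> kl; rewrite inE => /andP[/andP[->]].
rewrite big_mkcondl /=; apply: eq_bigr => kl lt_kl.
by rewrite inE lt_kl /=; case: ifP.
Qed.

Lemma sign_expM s t i :
  odd (sign_exp (t * s)%g i) = odd (sign_exp s (mshift t i)) (+) odd (sign_exp t i).
Proof.
rewrite !odd_sign_exp sgnXM; congr (_ (+) _).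
by apply: eq_sgnX => k; rewrite ffunE.
Qed.

Lemma sign_exp1 i : sign_exp 1%g i = 0%N.
Proof.
by apply: eq_card0 => kl; rewrite inE !perm1; case: ltngtP.
Qed.

Lemma perm_act1 (K : pzRingType) : perm_act K 1%g = 1%:M.
Proof.
apply/matrixP => a b; rewrite !mxE mshift1 sign_exp1 expr0.
by rewrite (inj_eq enum_val_inj); case: eqP.
Qed.

Lemma perm_actM (K : pzRingType) s t :
  perm_act K s *m perm_act K t = perm_act K (t * s)%g.
Proof.
rewrite mxT_mul; apply: eq_mxT => i j.
rewrite (bigD1 (mshift t j)) //= big1 ?addr0 => [|k /negbTE->]; last by rewrite mulr0.
rewrite eqxx mshiftM; case: eqP => _; last by rewrite mul0r.
by rewrite -exprD -[LHS]signr_odd oddD -sign_expM signr_odd.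
Qed.

Definition sym_act (K : comNzRingType) : galg K r -> EndV K :=
  galg_lift (fun c s => c *: perm_act K s).

End SuperTensor.

Section SymAct.
Variables (m n r : nat) (K : comNzRingType).
Local Notation E := (EndV m n r K).
Let w (c : K) s : E := c *: perm_act m n K s.

Fact sym_act_w_zmod s : zmod_morphism (w^~ s).
Proof. by move=> a b; rewrite /w scalerBl. Qed.
Fact sym_act_w1 : w 1 1%g = 1.
Proof. by rewrite /w scale1r perm_act1. Qed.
Fact sym_act_wM a b s t : w a s * w b t = w (a * b) (t * s)%g.
Proof.
by rewrite /w -[_ * _]/(_ *m _) -scalemxAl -scalemxAr scalerA perm_actM.
Qed.

HB.instance Definition _ := GRing.isZmodMorphism.Build (galg K r) E
  (@sym_act m n r K) (galg_lift_zmod sym_act_w_zmod).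
HB.instance Definition _ := GRing.isMonoidMorphism.Build (galg K r) E
  (@sym_act m n r K) (galg_lift_monoid sym_act_w_zmod sym_act_w1 sym_act_wM).
End SymAct.

(* Supercommutative superalgebras.  No condition a^2 = 0 on odd a is listed: it
   follows from [supercomm], as 2 is invertible in the fields considered.  An
   algType is nonzero; over the zero algebra commutation with GL is void. *)
Record superalg (K : fieldType) := SuperAlg {
  sa_alg :> algType K;
  homog : bool -> sa_alg -> Prop;
  homog0 : forall e, homog e 0;
  homog_linear : forall e (c : K) a b,
    homog e a -> homog e b -> homog e (c *: a + b);
  homog_decomp : forall a, exists! ab : sa_alg * sa_alg,
    [/\ homog false ab.1, homog true ab.2 & a = ab.1 + ab.2];
  homog1 : homog false 1;
  homogM : forall e e' a b,
    homog e a -> homog e' b -> homog (e (+) e') (a * b);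
  supercomm : forall e e' a b, homog e a -> homog e' b ->
    a * b = (-1) ^+ (e && e') * (b * a)
}.

Section GeneralLinear.
Variables (m n : nat) (K : fieldType) (A : superalg K).

(* V (x) A as a right A-module: the column v is \sum_i e_i (x) v_i, and the right
   action of a : A is v *m a%:M. *)
Definition VA := 'cV[A]_(m + n).

Definition base_vec (i : 'I_(m + n)) : VA := delta_mx i 0.

Definition homog_vec (e : bool) (v : VA) : Prop :=
  forall i, homog (e (+) is_odd i) (v i 0).

Record GLpoint := {
  gl_fun :> VA -> VA;
  gl_add : forall v w, gl_fun (v + w) = gl_fun v + gl_fun w;
  gl_scale : forall v (a : A), gl_fun (v *m a%:M) = gl_fun v *m a%:M;
  gl_parity : forall e v, homog_vec e v -> homog_vec e (gl_fun v);
  gl_bij : bijective gl_fun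
}.

Variable r : nat.

(* The coefficient of e_i in w_0 (x) ... (x) w_(r-1) under the identification
   (V (x) A) (x)_A ... (x)_A (V (x) A) = V^(x r) (x) A, for w_k homogeneous of
   parity e k: the coefficient of e_(i k) in w_k, of parity e k + |i k|, is moved
   to the right past e_(i l) for all l > k. *)
Definition pure_tensor (e : 'I_r -> bool) (w : 'I_r -> VA) (i : mindex m n r) : A :=
  (-1) ^+ (\sum_(kl : 'I_r * 'I_r | (kl.1 < kl.2)%N)
             ((e kl.1 (+) is_odd (i kl.1)) && is_odd (i kl.2)))%N *
  \prod_k w k (i k) 0.

Definition gl_act (g : GLpoint) : 'M[A]_#|mindex m n r| :=
  mxT (fun i j : mindex m n r =>
    pure_tensor (fun k => is_odd (j k)) (fun k => g (base_vec (j k))) i).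

End GeneralLinear.

Section Reorder.
Variables (K : fieldType) (A : superalg K).

Lemma prod_adj r (a b : 'I_r) (x : 'I_r -> A) (q : 'I_r -> bool) :
  b = a.+1 :> nat -> (forall k, homog (q k) (x k)) ->
  \prod_k x (tperm a b k) = (-1) ^+ (q a && q b) * \prod_k x k.
Proof.
case: r a b x q => [[]//|r] a b x q ab hx.
pose y i := x (inord i); pose z i := x (tperm a b (inord i)).
have yE : \prod_k x k = \prod_(0 <= i < r.+1) y i.
  by rewrite big_mkord; apply: eq_bigr => k _; rewrite /y inord_val.
have zE : \prod_k x (tperm a b k) = \prod_(0 <= i < r.+1) z i.
  by rewrite big_mkord; apply: eq_bigr => k _; rewrite /z inord_val.
have lb := ltn_ord b.
have eq_zy i : (i < r.+1)%N -> i != a -> i != b -> z i = y i.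
  by move=> ir ia ib; rewrite /z tpermD // -val_eqE /= inordK // eq_sym.
rewrite yE zE !(@big_cat_nat _ _ _ a 0 r.+1) //=; try lia.
rewrite !(@big_ltn _ _ _ a r.+1) //; try lia.
rewrite !(@big_ltn _ _ _ a.+1 r.+1) //; try lia.
rewrite (eq_big_nat _ _ (F2 := y)); last first.
  by move=> i /andP[_ ia]; apply: eq_zy; lia.
rewrite [in LHS](@eq_big_nat _ _ _ a.+2 _ _ y); last first.
  by move=> i /andP[ia ir]; apply: eq_zy; lia.
have -> : z a = x b by rewrite /z inord_val tpermL.
have -> : z a.+1 = x a by rewrite /z -ab inord_val tpermR.
have -> : y a = x a by rewrite /y inord_val.
have -> : y a.+1 = x b by rewrite /y -ab inord_val.
rewrite [x b * (x a * _)]mulrA (supercomm (hx b) (hx a)) andbC.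
rewrite [LHS]mulrA -signr_odd.
by case: (odd _); rewrite /= ?expr0 ?expr1 ?mul1r ?mulN1r ?mulNr ?mulrN ?mulNr -?mulrA.
Qed.

Lemma prod_reorder r (s : 'S_r) : forall (x : 'I_r -> A) (q : 'I_r -> bool),
  (forall k, homog (q k) (x k)) ->
  \prod_k x ((s^-1)%g k) = (-1) ^+ sgnX s q * \prod_k x k.
Proof.
elim/perm_adj_ind: s => [|s t IHs IHt|a b ab] x q hx.
- rewrite sgnX1 expr0 mul1r; apply: eq_bigr => k _.
  by rewrite invg1 perm1.
- rewrite sgnXM signr_addb -mulrA -(IHs x q hx).
  rewrite -(IHt (fun k => x ((s^-1)%g k)) (fun k => q ((s^-1)%g k))) //.
  by apply: eq_bigr => k _; rewrite invMg permM.
by rewrite tpermV sgnX_adj //; exact: prod_adj.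
Qed.
End Reorder.

Section Commutation.
Variables (m n r : nat) (K : fieldType) (A : superalg K) (g : GLpoint m n A).

Lemma homog_base i : homog_vec (is_odd i) (base_vec A i : VA m n A).
Proof.
move=> j; rewrite mxE eqxx andbT; case: eqP => [->|_] /=; last exact: homog0.
by rewrite addbb; exact: homog1.
Qed.

Lemma gl_act_shift (s : 'S_r) (i j : mindex m n r) (T := fun i j : mindex m n r =>
    pure_tensor (fun k => is_odd (j k)) (fun k => g (base_vec A (j k))) i) :
  T (mshift s i) (mshift s j) = (-1) ^+ (sign_exp s i + sign_exp s j) * T i j.
Proof.
rewrite /T /pure_tensor.
pose q k := is_odd (j k) (+) is_odd (i k).
pose x k := g (base_vec A (j k)) (i k) 0.
have hx k : homog (q k) (x k) by apply: gl_parity; exact: homog_base.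
have -> : \prod_k g (base_vec A (mshift s j k)) (mshift s i k) 0 =
          \prod_k x ((s^-1)%g k) by apply: eq_bigr => k _; rewrite !ffunE.
rewrite (prod_reorder _ hx) !mulrA; congr (_ * _).
rewrite -!exprD -[LHS]signr_odd -[RHS]signr_odd; congr (_ ^+ (nat_of_bool _)).
rewrite !oddD !odd_sign_exp oddb !(big_morph odd oddD (erefl : odd 0 = false)).
pose G k l := q k && is_odd (i l).
rewrite (eq_bigr (fun kl => G ((s^-1)%g kl.1) ((s^-1)%g kl.2))); last first.
  by move=> kl _; rewrite oddb !ffunE.
rewrite pairs_reindex /sgnX -!big_split /=; apply: eq_bigr => -[k l] /= kl.
have nst : s k != s l :> nat.
  by apply: contraTneq kl => /val_inj/perm_inj->; rewrite ltnn.
rewrite oddb /G /q; case: (ltngtP (s k) (s l)) nst => //= _ _;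
  by case: (is_odd (i k)); case: (is_odd (i l)); case: (is_odd (j k)); case: (is_odd (j l)).
Qed.

Lemma perm_act_comm (s : 'S_r) :
  map_mx (in_alg A) (perm_act m n K s) *m gl_act r g =
  gl_act r g *m map_mx (in_alg A) (perm_act m n K s).
Proof.
have -> : map_mx (in_alg A) (perm_act m n K s) =
    mxT (fun i j : mindex m n r => if i == mshift s j then (-1) ^+ sign_exp s j else 0).
  apply/matrixP => a b; rewrite !mxE; case: ifP => _; last by rewrite rmorph0.
  by rewrite rmorphXn rmorphN1.
rewrite !mxT_mul; apply: eq_mxT => i j.
rewrite (bigD1 (mshift s^-1%g i)) //= [in RHS](bigD1 (mshift s j)) //=.
rewrite big1 ?addr0 => [|k kE]; last first.
  case: eqP => [e|_]; rewrite ?mul0r //.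
  by move: kE; rewrite e mshiftK eqxx.
rewrite [in RHS]big1 ?addr0 => [|k /negbTE->]; last by rewrite mulr0.
set i' := mshift s^-1%g i.
have -> : i = mshift s i' by rewrite mshiftM mulVg mshift1.
rewrite !eqxx gl_act_shift -[in RHS]signr_odd oddD signr_addb.
rewrite -[(-1) ^+ sign_exp s i']signr_odd -[(-1) ^+ sign_exp s j]signr_odd.
case: (odd _); case: (odd _);
  by rewrite /= ?expr0 ?expr1 ?mulrN1 ?mulN1r ?mul1r ?mulr1 ?mulNr ?mul1r ?opprK.
Qed.
End Commutation.

Section EndGL.
Variables (m n r : nat) (K : fieldType).
Local Notation E := (EndV m n r K).

Definition mparity (i : mindex m n r) : bool := odd #|[set k | is_odd (i k)]|.

Definition parity_preserving (phi : E) : Prop :=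
  forall a b, mparity (enum_val a) != mparity (enum_val b) -> phi a b = 0.

(* phi (x) id_A is the right A-linear extension of phi.  A ranges over all
   supercommutative superalgebras: commutation is with the group functor, not
   with its K-points only. *)
Definition commutes_with_GL (phi : E) : Prop :=
  forall (A : superalg K) (g : GLpoint m n A),
    map_mx (in_alg A) phi *m gl_act r g = gl_act r g *m map_mx (in_alg A) phi.

Definition EndGL_pred : {pred E} :=
  fun phi => `[< parity_preserving phi /\ commutes_with_GL phi >].

Lemma EndGL_predP phi :
  reflect (parity_preserving phi /\ commutes_with_GL phi) (phi \in EndGL_pred).
Proof. exact: asboolP. Qed.

Fact EndGL_subring : subring_closed EndGL_pred.
Proof.
split=> [|x y|x y].
- apply/EndGL_predP; split=> [a b ab|A g].
    rewrite -[1]/(1%:M) mxE; case: eqP => [e|_]; last by rewrite mulr0n.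
    by rewrite e eqxx in ab.
  by rewrite -[1]/(1%:M) map_mx1 mul1mx mulmx1.
- move=> /EndGL_predP[px cx] /EndGL_predP[py cy]; apply/EndGL_predP; split.
    by move=> a b ab; rewrite !mxE px // py // subrr.
  by move=> A g; rewrite map_mxB mulmxBl mulmxBr cx cy.
move=> /EndGL_predP[px cx] /EndGL_predP[py cy]; apply/EndGL_predP; split.
  move=> a b ab; rewrite mxE big1 // => c _.
  case: (eqVneq (mparity (enum_val a)) (mparity (enum_val c))) => [ac|ac].
    by rewrite py ?mulr0 // -ac.
  by rewrite px // mul0r.
by move=> A g; rewrite -[x * y]/(x *m y) map_mxM -mulmxA cy mulmxA cx mulmxA.
Qed.

Fact EndGL_scaler : scaler_closed EndGL_pred.
Proof.
move=> c x /EndGL_predP[px cx]; apply/EndGL_predP; split.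
  by move=> a b ab; rewrite mxE px // mulr0.
move=> A g.
have cA k : GRing.comm (in_alg A c) k by rewrite /GRing.comm /= mulr_algl mulr_algr.
rewrite map_mxZ -scalemxAl cx; apply/matrixP => a b.
rewrite !mxE big_distrr /=; apply: eq_bigr => k _.
by rewrite !mxE /= mulrA cA !mulrA.
Qed.

HB.instance Definition _ := GRing.isSubringClosed.Build E EndGL_pred EndGL_subring.
HB.instance Definition _ := GRing.isScaleClosed.Build K E EndGL_pred EndGL_scaler.

Record EndGL := MkEndGL { EndGL_val :> E; EndGL_valP : EndGL_val \in EndGL_pred }.
HB.instance Definition _ := [isSub for EndGL_val].
HB.instance Definition _ := [Choice of EndGL by <:].
HB.instance Definition _ := 
  GRing.SubChoice_isSubPzRing.Build E EndGL_pred EndGL (subringClosedP _).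
HB.instance Definition _ := [SubZmodule_isSubLmodule of EndGL by <:].

Lemma perm_act_EndGL (s : 'S_r) : perm_act m n K s \in EndGL_pred.
Proof.
apply/EndGL_predP; split=> [a b ab|A g]; last exact: perm_act_comm.
rewrite mxE; case: eqP => // e; move: ab; rewrite e /mparity.
suff -> : #|[set k | is_odd (mshift s (enum_val b) k)]| =
          #|[set k | is_odd (enum_val b k)]| by rewrite eqxx.
rewrite -[RHS](card_imset _ (@perm_inj _ s)); apply: eq_card => k.
rewrite inE ffunE; apply/idP/imsetP => [h|[l]].
  by exists ((s^-1)%g k); rewrite ?inE // permKV.
by rewrite inE => h ->; rewrite permK.
Qed.

Definition perm_EndGL (s : 'S_r) : EndGL := MkEndGL (perm_act_EndGL s).

Definition Phi : galg K r -> EndGL := galg_lift (fun c s => c *: perm_EndGL s).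

Fact Phi_w_zmod s : zmod_morphism (fun c => c *: perm_EndGL s).
Proof. by move=> a b; rewrite scalerBl. Qed.
Fact Phi_w1 : 1 *: perm_EndGL 1%g = 1.
Proof. by rewrite scale1r; apply: val_inj; exact: perm_act1. Qed.
Fact Phi_wM a b s t :
  (a *: perm_EndGL s) * (b *: perm_EndGL t) = (a * b) *: perm_EndGL (t * s)%g.
Proof. by apply: val_inj; exact: sym_act_wM. Qed.

HB.instance Definition _ := GRing.isZmodMorphism.Build (galg K r) EndGL Phi
  (galg_lift_zmod Phi_w_zmod).
HB.instance Definition _ := GRing.isMonoidMorphism.Build (galg K r) EndGL Phi
  (galg_lift_monoid Phi_w_zmod Phi_w1 Phi_wM).

Fact Phi_scalable : scalable Phi.
Proof.
move=> c y; rewrite /Phi /galg_lift scaler_sumr; apply: eq_bigr => s _.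
by rewrite ffunE scalerA.
Qed.
End EndGL.

Section Sigma.
Variables (m n r p : nat).
Local Notation E := (EndV m n r int).

Definition SigmaZ_pred : {pred E} :=
  fun x => `[< exists (i : nat) (y : galg int r), x *+ p ^ i = sym_act m n y >].

Lemma SigmaZ_predP x :
  reflect (exists (i : nat) (y : galg int r), x *+ p ^ i = sym_act m n y)
          (x \in SigmaZ_pred).
Proof. exact: asboolP. Qed.

Fact SigmaZ_subring : subring_closed SigmaZ_pred.
Proof.
split=> [|x y|x y].
- apply/SigmaZ_predP; exists 0%N, 1.
  by rewrite expn0 mulr1n [RHS]rmorph1.
- move=> /SigmaZ_predP[i [u xu]] /SigmaZ_predP[j [v yv]]; apply/SigmaZ_predP.
  exists (i + j)%N, (u *+ p ^ j - v *+ p ^ i).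
  rewrite rmorphB !rmorphMn /= -xu -yv mulrnBl -!mulrnA expnD.
  by rewrite [(p ^ j * p ^ i)%N]mulnC.
move=> /SigmaZ_predP[i [u xu]] /SigmaZ_predP[j [v yv]]; apply/SigmaZ_predP.
exists (i + j)%N, (u * v).
by rewrite rmorphM /= -xu -yv expnD mulrnAl mulrnAr -mulrnA mulnC.
Qed.
HB.instance Definition _ := GRing.isSubringClosed.Build E SigmaZ_pred SigmaZ_subring.

Record SigmaZ := MkSigmaZ { SigmaZ_val :> E; _ : SigmaZ_val \in SigmaZ_pred }.
HB.instance Definition _ := [isSub for SigmaZ_val].
HB.instance Definition _ := [Choice of SigmaZ by <:].
HB.instance Definition _ := 
  GRing.SubChoice_isSubPzRing.Build E SigmaZ_pred SigmaZ (subringClosedP _).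

Lemma sym_act_SigmaZ (y : galg int r) : sym_act m n y \in SigmaZ_pred.
Proof. by apply/SigmaZ_predP; exists 0%N, y; rewrite expn0. Qed.

Definition f_SigmaZ (y : galg int r) : SigmaZ := MkSigmaZ (sym_act_SigmaZ y).

Fact f_SigmaZ_zmod : zmod_morphism f_SigmaZ.
Proof. by move=> x y; apply: val_inj; exact: rmorphB. Qed.
Fact f_SigmaZ_monoid : monoid_morphism f_SigmaZ.
Proof.
by split=> [|x y]; apply: val_inj; [exact: rmorph1|exact: rmorphM].
Qed.
HB.instance Definition _ :=
  GRing.isZmodMorphism.Build (galg int r) SigmaZ f_SigmaZ f_SigmaZ_zmod.
HB.instance Definition _ :=
  GRing.isMonoidMorphism.Build (galg int r) SigmaZ f_SigmaZ f_SigmaZ_monoid.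
End Sigma.

Definition galg_delta (K : comNzRingType) (r : nat) (s : 'S_r) : galg K r :=
  [ffun t => (t == s)%:R].

Section SigmaK.
Variables (m n r p : nat) (K : fieldType).

Definition Sigma := tensor K (SigmaZ m n r p).
HB.instance Definition _ := GRing.PzRing.on Sigma.
HB.instance Definition _ := GRing.Lmodule.on Sigma.

(* The base change to K of f_SigmaZ, with K (x) Z S_r = K S_r. *)
Definition f_Sigma : galg K r -> Sigma :=
  galg_lift (fun c s => tens c (f_SigmaZ m n p (galg_delta int s))).

Lemma galg_delta1 : galg_delta int (1%g : 'S_r) = 1.
Proof. by []. Qed.

Lemma galg_deltaM (s t : 'S_r) :
  galg_delta int s * galg_delta int t = galg_delta int (t * s)%g.
Proof.
apply/ffunP => u; rewrite !ffunE (bigD1 s) //= big1 ?addr0.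
  by rewrite !ffunE eqxx mul1r -(inj_eq (mulIg s)) mulgKV.
by move=> v /negbTE vs; rewrite ffunE vs mul0r.
Qed.

Let w (c : K) s : Sigma := tens c (f_SigmaZ m n p (galg_delta int s)).
Fact f_Sigma_w_zmod s : zmod_morphism (w^~ s).
Proof.
by move=> a b; have hb := tens_biadditive K (SigmaZ m n r p);
  rewrite /w hb.1 (biadditiveNl hb).
Qed.
Fact f_Sigma_w1 : w 1 1%g = 1.
Proof. by rewrite /w galg_delta1 rmorph1. Qed.
Fact f_Sigma_wM a b s t : w a s * w b t = w (a * b) (t * s)%g.
Proof. by rewrite /w mul_tens -rmorphM galg_deltaM. Qed.
HB.instance Definition _ := GRing.isZmodMorphism.Build (galg K r) Sigma f_Sigma
  (galg_lift_zmod f_Sigma_w_zmod).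
HB.instance Definition _ := GRing.isMonoidMorphism.Build (galg K r) Sigma f_Sigma
  (galg_lift_monoid f_Sigma_w_zmod f_Sigma_w1 f_Sigma_wM).

Fact f_Sigma_scalable : scalable f_Sigma.
Proof.
move=> c y; rewrite /f_Sigma /galg_lift scaler_sumr; apply: eq_bigr => s _.
by rewrite scale_tens ffunE.
Qed.
End SigmaK.

(* Main.v *)
Require Import Defs.
From HB Require Import structures.
From mathcomp Require Import all_boot all_order all_fingroup all_algebra.
From mathcomp Require Import boolp reals complex.

Set Implicit Arguments.
Unset Strict Implicit.
Unset Printing Implicit Defensive.

Import GRing.Theory.
Local Open Scope ring_scope.

(** The argument compares everything with one lattice. The lattice
    [SigmaZ m n r p] is the p-saturation, inside the integer matrices, of the
    span of the signed permutation matrices. By the Smith normal form it has a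
    Z-basis b_1, ..., b_d which stays linearly independent over every field of
    characteristic 0 or p ([saturated_basis], [SigmaZ_basis]): dividing out the
    p-parts of the elementary divisors leaves coefficients prime to p. Hence
    K (x) SigmaZ has dimension d, and its map to matrices over K is injective.

    The image of that map commutes with GL(m|n) ([SigmaZ_EndGL]). The matrix of
    a point of GL(m|n) on the tensor power is equivariant under S_r up to a
    sign, and such a matrix, once 2 is invertible, is a combination of the
    images of integer matrices [orbit_mx u], one for each S_r-orbit of pairs of
    multi-indices ([equivariant_decomp]); orbits on which the signs conflict
    contribute zero, because there x = - x. These integer matrices commute with
    S_r, hence with every x such that a multiple p^i x comes from Z S_r, since
    integer matrices have no torsion. The commutation then survives reduction.

    Over a field of characteristic 0 the centralizer of GL(m|n) is spanned by
    the permutation matrices ([super_schur_weyl]), so its dimension is d as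
    well. If phi commutes with GL(m|n), it commutes with the action of
    g = 1 + \sum_l xi_l E_(i_l j_l), where the xi_l are supercommuting
    square-zero parameters of the parity of E_(i_l j_l). Comparing the
    coefficients of the product of all the xi_l shows that phi commutes with
    the orbit matrix of (i, j), up to a nonzero integer factor
    ([EndGL_comm_orbit_mx]). The orbit matrices span the centralizer of S_r, so
    phi lies in the double centralizer of S_r, which by averaging is the span
    of S_r ([double_centralizer]).

    The last claim is the fact that an injective linear map from a space of
    dimension d is bijective exactly when its target has dimension d
    ([bijective_dim]). *)

(** * Finite dimension *)

Section DimensionTheory.
Variable K : fieldType.

Lemma is_basisP (V : lmodType K) d (b : 'I_d -> V) :
  (forall v, exists c : 'I_d -> K, v = \sum_i c i *: b i) ->
  (forall c : 'I_d -> K, \sum_i c i *: b i = 0 -> forall i, c i = 0) ->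
  is_basis b.
Proof.
move=> spanb freeb v; have [c vE] := spanb v.
exists [ffun i => c i]; split=> [|c' vE'].
  by rewrite vE; apply: eq_bigr => i _; rewrite ffunE.
apply/ffunP => i; rewrite ffunE; apply/eqP; rewrite -subr_eq0; apply/eqP; move: i.
apply: (freeb (fun i => c i - c' i)).
under eq_bigr => i _ do rewrite scalerBl.
by rewrite sumrB -vE -vE' subrr.
Qed.

Lemma is_basis_free (V : lmodType K) d (b : 'I_d -> V) : is_basis b ->
  forall c : 'I_d -> K, \sum_i c i *: b i = 0 -> forall i, c i = 0.
Proof.
move=> bb c c0 i; have [z [_ zU]] := bb 0.
have z1 : z = 0 by apply: zU; rewrite big1 // => j _; rewrite ffunE scale0r.
have z2 : z = [ffun j => c j].
  by apply: zU; rewrite -[LHS]c0; apply: eq_bigr => j _; rewrite ffunE.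
by have /ffunP/(_ i) := z2; rewrite z1 !ffunE.
Qed.

(** In coordinates f is a matrix with independent rows, so d is its rank; when
    d = d' it is invertible. *)
Lemma injective_dim (V W : lmodType K) (f : {linear V -> W}) d d' :
    injective f -> has_dim V d -> has_dim W d' ->
  (d <= d')%N /\ (d = d' -> forall w, exists v, f v = w).
Proof.
move=> f_inj [b bb] [b' bb'].
have /fin_all_exists[M fb] : forall j, exists c : {ffun 'I_d' -> K},
    f (b j) = \sum_i c i *: b' i.
  by move=> j; have [c [cE _]] := bb' (f (b j)); exists c.
pose A := \matrix_(j, i) M j i.
have fA (u : 'rV_d) : f (\sum_j u 0 j *: b j) = \sum_i (u *m A) 0 i *: b' i.
  rewrite linear_sum; under eq_bigr => j _ do rewrite linearZ /= fb scaler_sumr.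
  rewrite exchange_big; apply: eq_bigr => i _; rewrite mxE scaler_suml.
  by apply: eq_bigr => j _; rewrite scalerA mxE.
have freeA : row_free A.
  rewrite -kermx_eq0; apply/rowV0P => u /sub_kermxP uA.
  apply/rowP => j; rewrite mxE; apply: (is_basis_free bb (c := fun j => u 0 j)).
  apply: f_inj; rewrite fA uA linear0 big1 // => i _.
  by rewrite mxE scale0r.
split=> [|dd' w]; first by rewrite -(eqP freeA) rank_leq_col.
have fullA : row_full A by rewrite /row_full (eqP freeA) dd'.
have [c [wE _]] := bb' w.
have /submxP[u uE] := submx_full (\row_i c i) fullA.
exists (\sum_j u 0 j *: b j); rewrite fA -uE wE.
by apply: eq_bigr => i _; rewrite mxE.
Qed.

Lemma has_dim_uniq (V : lmodType K) d d' : has_dim V d -> has_dim V d' -> d = d'.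
Proof.
move=> hd hd'; apply/eqP; rewrite eqn_leq.
by rewrite (injective_dim (f := idfun) _ hd hd').1 ?(injective_dim (f := idfun) _ hd' hd).1.
Qed.

Lemma bijective_dim (V W : lmodType K) (f : {linear V -> W}) d :
  injective f -> has_dim V d -> bijective f <-> has_dim W d.
Proof.
move=> f_inj hV; split=> [[g fK gK]|hW].
  have [b bb] := hV; exists (f \o b); apply: is_basisP => [w|c c0].
    have [c [gw _]] := bb (g w); exists c.
    by rewrite -[w]gK gw linear_sum; apply: eq_bigr => i _; rewrite linearZ.
  apply: (is_basis_free bb); apply: f_inj; rewrite linear0 -[RHS]c0 linear_sum.
  by apply: eq_bigr => i _; rewrite linearZ.
have /choice[g gK] := (injective_dim f_inj hV hW).2 erefl.
by exists g => // v; apply: f_inj; rewrite gK.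
Qed.
End DimensionTheory.

(** * Saturated sublattices *)

Lemma map_unitmx_int (F : comUnitRingType) n (R : 'M[int]_n) :
  R \in unitmx -> map_mx (intr : int -> F) R \in unitmx.
Proof. by rewrite !unitmxE det_map_mx; apply: rmorph_unit. Qed.

Lemma intr_neq0_coprime (F : fieldType) (p : nat) (z : int) :
    prime p -> [pchar F] =i pred0 \/ p \in [pchar F] ->
  z != 0 -> coprime p `|z| -> z%:~R != 0 :> F.
Proof.
move=> p_pr charF z0 pz.
rewrite [z]intEsign rmorphM rmorph_sign mulf_eq0 signr_eq0 /= -pmulrn.
case: charF => [/pcharf0P->|pF]; first by rewrite absz_eq0.
by rewrite -(dvdn_pcharf pF) -prime_coprime.
Qed.

(** In the coordinates of a Smith normal form G = L D R, the row lattice of G is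
    generated by e_l R_l, for e_l the elementary divisors and R_l the rows of
    the unimodular R. Its p-saturation is generated by q_l R_l, for q_l the part
    of e_l prime to p. As q_l and det R are nonzero in a field of characteristic
    0 or p, these generators remain independent there. *)
Lemma saturated_basis (p : nat) (a d : nat) (G : 'M[int]_(a, d)) : prime p ->
  exists (rho : nat) (B : 'M[int]_(rho, d)),
    (forall v : 'rV_d, (exists i (u : 'rV_a), v *+ p ^ i = u *m G) <->
                       (exists c : 'rV_rho, v = c *m B)) /\
    (forall F : fieldType, [pchar F] =i pred0 \/ p \in [pchar F] ->
       row_free (map_mx (intr : int -> F) B)).
Proof.
move=> p_pr.
have [L Lu [R Ru [e _ ->]]] := int_Smith_normal_form G.
pose el (l : nat) : int := e`_l.
pose D := \matrix_(i < a, j < d) (el i *+ (i == j :> nat)).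
pose I := [set l : 'I_d | (l < a)%N && (el l != 0)].
pose k l := logn p `|el l|%N.
pose q l : int := sgz (el l) * (`|el l|`_p^')%N%:Z.
have elE l : el l = q l * p%:Z ^+ k l.
  have [el0|el0] := eqVneq (el l) 0; first by rewrite /q el0 sgz0 !mul0r.
  rewrite {1}[el l]intEsg /q -mulrA -[p%:Z]natz -natrX natz -PoszM; congr (_ * Posz _).
  by rewrite /k -p_part mulnC partnC // absz_gt0.
have pq l : el l != 0 -> coprime p `|q l|%N.
  move=> el0; rewrite /q abszM -sgrz absz_sg el0 mul1n absz_nat.
  by apply: pnat_coprime (part_pnat _ _); rewrite pnat_id.
pose Dq : 'M[int]_(#|I|, d) := \matrix_(j, l) (q l *+ (enum_val j == l)).
exists #|I|, (Dq *m R).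
have DE (w : 'rV_a) l :
    (w *m D) 0 l = if insub (val l) is Some i then w 0 i * el l else 0.
  rewrite mxE; case: insubP => [i _ il|nl].
    rewrite (bigD1 i) //= big1 ?addr0 => [|j ji].
      by rewrite mxE il eqxx mulr1n.
    rewrite mxE; case: eqP => [jl|_]; last by rewrite mulr0.
    by case/eqP: ji; apply: val_inj; rewrite /= il jl.
  rewrite big1 // => i _; rewrite mxE; case: eqP => [il|_]; last by rewrite mulr0.
  by move: nl; rewrite /= -[X in (X < _)%N]il ltn_ord.
have DqE (T : pzRingType) (f : {rmorphism int -> T}) (c : 'rV_#|I|) j :
    (c *m map_mx f Dq) 0 (enum_val j) = c 0 j * f (q (enum_val j)).
  rewrite mxE (bigD1 j) //= big1 ?addr0 => [|i ij]; first by rewrite !mxE eqxx.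
  by rewrite !mxE (inj_eq enum_val_inj) (negbTE ij) raddf0 mulr0.
have DqE' (c : 'rV_#|I|) j : (c *m Dq) 0 (enum_val j) = c 0 j * q (enum_val j).
  by rewrite -[RHS](DqE _ idfun) map_mx_id.
have DqN (c : 'rV_#|I|) l : l \notin I -> (c *m Dq) 0 l = 0.
  move=> lI; rewrite mxE big1 // => j _; rewrite mxE.
  by case: eqP => [jl|_]; rewrite ?mulr0 //; move: lI; rewrite -jl enum_valP.
split=> [v|F charF]; last first.
  rewrite -kermx_eq0; apply/rowV0P => u /sub_kermxP; rewrite map_mxM mulmxA => uBR.
  have uB : u *m map_mx intr Dq = 0 :> 'rV[F]_d.
    by rewrite -(mulmxK (map_unitmx_int F Ru) (u *m _)) uBR mul0mx.
  apply/rowP => j; rewrite [RHS]mxE.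
  have := enum_valP j; rewrite inE => /andP[_ ej0].
  have q0 : q (enum_val j) != 0.
    by apply: contra_neq ej0; rewrite elE => ->; rewrite mul0r.
  apply/(mulIf (intr_neq0_coprime p_pr charF q0 (pq _ ej0))).
  by rewrite mul0r -DqE uB mxE.
split=> [[i [u vE]]|[c ->]].
  pose v' := v *m invmx R.
  have v'E l : v' 0 l * (p ^ i)%:Z = (u *m L *m D) 0 l.
    have -> : u *m L *m D = v' *+ p ^ i.
      by rewrite /v' -scaler_nat scalemxAl scaler_nat vE -!mulmxA mulmxV // mulmx1.
    by rewrite -scaler_nat [RHS]mxE natz mulrC.
  exists (\row_j divz (v' 0 (enum_val j)) (q (enum_val j))).
  have vR : v = v' *m R by rewrite /v' mulmxKV.
  rewrite [LHS]vR mulmxA; congr (_ *m R); apply/rowP => l.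
  have p0 : (p ^ i)%:Z != 0 by rewrite -lt0n expn_gt0 prime_gt0.
  have := v'E l; rewrite DE; have [lI|lI] := boolP (l \in I); last first.
    rewrite DqN //; move: lI; rewrite inE.
    have v'0 x : x = 0 -> v' 0 l * (p ^ i)%:Z = x -> v' 0 l = 0.
      by move=> -> /eqP; rewrite mulf_eq0 (negbTE p0) orbF => /eqP.
    case: insubP => [i0 -> _ /=|_ _]; last exact: v'0.
    by rewrite negbK => /eqP ->; apply: v'0; rewrite mulr0.
  move=> v'p; pose j := enum_rank_in lI l.
  have jl : enum_val j = l by rewrite enum_rankK_in.
  rewrite -jl DqE' [X in _ = X * _]mxE divzK // jl.
  move: (lI) v'p; rewrite inE => /andP[la l0].
  rewrite insubT elE => v'p.
  have : v' 0 l * (p ^ i)%:Z \in dvdz (q l) by rewrite v'p mulrCA dvdz_mulr.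
  by rewrite Gauss_dvdzl // coprimez_sym coprimezE absz_nat coprimeXl ?pq.
(* Any exponent that is at least every [k l] works; their sum is one. *)
pose K := (\sum_(l in I) k l)%N; exists K.
(* The sum has at most one term: it selects the generator of index i, if any. *)
pose w : 'rV[int]_a :=
  \row_i \sum_(j < #|I| | enum_val j == i :> nat) c 0 j * p%:Z ^+ (K - k i).
exists (w *m invmx L).
rewrite !mulmxA mulmxKV // -[LHS]scaler_nat scalemxAl; congr (_ *m R).
apply/rowP => l; rewrite DE [LHS]mxE.
have [lI|lI] := boolP (l \in I); last first.
  rewrite DqN // mulr0; move: lI; rewrite inE.
  by case: insubP => [i0 -> _ /=|//]; rewrite negbK => /eqP ->; rewrite mulr0.
have la : (l < a)%N by move: lI; rewrite inE => /andP[].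
have K_l : (k l <= K)%N by rewrite /K (bigD1 l) //= leq_addr.
pose j := enum_rank_in lI l; have jl : enum_val j = l by rewrite enum_rankK_in.
rewrite -[in LHS]jl DqE' jl insubT mxE (big_pred1 j) => [|j'] /=; last first.
  by rewrite -jl (inj_eq val_inj) (inj_eq enum_val_inj).
by rewrite elE [RHS]mulrACA -exprD subnK // natrX natz mulrC.
Qed.

(** * Double centralizers of finite groups *)

Section DoubleCentralizer.
Variables (F : fieldType) (gT : finGroupType) (N : nat) (P : gT -> 'M[F]_N).
Hypotheses (P1 : P 1%g = 1%:M) (PM : forall x y, P (x * y)%g = P x *m P y).
Hypothesis card_unit : #|gT|%:R != 0 :> F.

(** Averaging over the group a linear projection of 'M_N onto the span B of the
    P x, as in the proof of Maschke's theorem, gives a map pi onto B that fixes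
    1 and commutes with left multiplication by every P x. Each pair of columns
    (b, c) extracts from pi an N x N matrix M b c commuting with the P x, hence
    with phi; so pi also commutes with left multiplication by phi, and
    phi = phi pi(1) = pi(phi) lies in B. *)
Lemma double_centralizer (phi : 'M[F]_N) :
    (forall M : 'M[F]_N, (forall x, P x *m M = M *m P x) -> phi *m M = M *m phi) ->
  exists c : gT -> F, phi = \sum_x c x *: P x.
Proof.
move=> phi_comm.
pose B := (\sum_x <[P x]>)%VS.
have memB X : X \in B -> exists c : gT -> F, X = \sum_x c x *: P x.
  case/memv_sumP => v vP ->.
  have /choice[c cE] x : exists c, v x = c *: P x by apply/vlineP/vP.
  by exists c; apply: eq_bigr => x _.
have PB x : P x \in B by rewrite (subvP (sumv_sup x _ (subvv _))) ?memv_line.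
have mulPB x X : X \in B -> P x *m X \in B.
  case/memB => c ->; rewrite mulmx_sumr; apply: memv_suml => y _.
  by rewrite -scalemxAr -PM memvZ.
pose pi X := #|gT|%:R^-1 *: \sum_x P x *m projv B (P x^-1%g *m X).
have piB X : pi X \in B.
  by apply/memvZ/memv_suml => x _; apply/mulPB/memv_proj.
have pi1 : pi 1%:M = 1%:M.
  rewrite /pi (eq_bigr (fun=> 1%:M)) => [|x _].
    by rewrite sumr_const -scaler_nat scalerA mulVf ?scale1r.
  by rewrite mulmx1 projv_id // -PM mulgV P1.
have pi_lin a X Y : pi (a *: X + Y) = a *: pi X + pi Y.
  rewrite /pi scalerA mulrC -scalerA -scalerDr; congr (_ *: _).
  rewrite scaler_sumr -big_split; apply: eq_bigr => x _ /=.
  by rewrite mulmxDr -scalemxAr linearP /= mulmxDr -scalemxAr.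
have piP y X : pi (P y *m X) = P y *m pi X.
  rewrite /pi -scalemxAr mulmx_sumr; congr (_ *: _).
  rewrite (reindex_inj (mulgI y)) /=; apply: eq_bigr => x _.
  by rewrite mulmxA PM -mulmxA invMg !mulmxA -!PM mulgKV.
(* Column c of the image under pi of the matrix whose only column is u, at b;
   the transpositions fit the convention that matrices act on row vectors. *)
pose h b c (u : 'rV[F]_N) : 'rV[F]_N :=
  (pi (u^T *m delta_mx 0 b) *m delta_mx c 0)^T.
have h_lin b c : linear (h b c).
  move=> a u v.
  by rewrite /h linearP /= mulmxDl -scalemxAl pi_lin mulmxDl -scalemxAl linearP.
pose hL b c := GRing.isLinear.Build F _ _ _ (h b c) (h_lin b c).
pose HL b c : {linear 'rV[F]_N -> 'rV[F]_N} := HB.pack (h b c) (hL b c).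
pose M b c := (lin1_mx (HL b c))^T.
have hE b c (u : 'cV_N) : pi (u *m delta_mx 0 b) *m delta_mx c 0 = M b c *m u.
  apply: trmx_inj; rewrite [RHS]trmx_mul.
  by rewrite /M trmxK (mul_rV_lin1 (HL b c)) /= /h trmxK.
have mulmx_ext (X Y : 'M[F]_N) : (forall u : 'cV_N, X *m u = Y *m u) -> X = Y.
  move=> eqXY; apply/matrixP => i j.
  by have /colP/(_ i) := eqXY (delta_mx j 0); rewrite -!colE !mxE.
have phiM b c : phi *m M b c = M b c *m phi.
  apply: phi_comm => x; apply: mulmx_ext => u.
  by rewrite -!mulmxA -!hE mulmxA -piP !mulmxA.
have sum_cols X : X = \sum_b col b X *m delta_mx 0 b.
  rewrite -[X in LHS]mulmx1 mx1_sum_delta mulmx_sumr; apply: eq_bigr => b _.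
  by rewrite colE -mulmxA mul_delta_mx.
have piD X Y : pi (X + Y) = pi X + pi Y by rewrite -[X]scale1r pi_lin !scale1r.
have pi0 : pi 0 = 0.
  by rewrite /pi big1 ?scaler0 // => x _; rewrite mulmx0 linear0 mulmx0.
have piphi X : pi (phi *m X) = phi *m pi X.
  apply: mulmx_ext => u.
  rewrite [X]sum_cols mulmx_sumr !(big_morph pi piD pi0) !mulmx_sumr !mulmx_suml.
  apply: eq_bigr => b _.
  have colsE Y : Y *m u = \sum_c u c 0 *: (Y *m delta_mx c 0).
    rewrite {1}[u]matrix_sum_delta mulmx_sumr; apply: eq_bigr => c _.
    by rewrite big_ord1 -scalemxAr.
  rewrite -mulmxA !colsE mulmx_sumr; apply: eq_bigr => c _.
  by rewrite -scalemxAr mulmxA hE mulmxA -phiM -mulmxA -hE mulmxA.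
by apply: memB; rewrite -[phi]mulmx1 -pi1 -piphi mulmx1.
Qed.
End DoubleCentralizer.

(** * Signed orbit matrices *)

Section Orbits.
Variables m n r : nat.
Local Notation mindex := (mindex m n r).
Implicit Types (s t : 'S_r) (i j : mindex) (u v : mindex * mindex).

Definition pshift s u : mindex * mindex := (mshift s u.1, mshift s u.2).
Definition pair_sign s u : bool := odd (sign_exp s u.1) (+) odd (sign_exp s u.2).

Lemma pshiftM s t u : pshift s (pshift t u) = pshift (t * s)%g u.
Proof. by rewrite /pshift !mshiftM. Qed.

Lemma pshift1 u : pshift 1%g u = u.
Proof. by case: u => i j; rewrite /pshift !mshift1. Qed.

Lemma pair_signM s t u :
  pair_sign (t * s)%g u = pair_sign s (pshift t u) (+) pair_sign t u.
Proof. by rewrite /pair_sign !sign_expM addbACA. Qed.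

Lemma pair_sign1 u : pair_sign 1%g u = false.
Proof. by rewrite /pair_sign !sign_exp1. Qed.

Definition equivariant (A : pzRingType) (F : mindex -> mindex -> A) : Prop :=
  forall s i j, F (mshift s i) (mshift s j) = (-1) ^+ pair_sign s (i, j) * F i j.

(** The orbits on which an equivariant function can be nonzero: elsewhere some
    stabilizing permutation forces F u.1 u.2 = - F u.1 u.2. *)
Definition unsigned u : bool := [forall s, (pshift s u == u) ==> ~~ pair_sign s u].

Lemma pair_sign_unsigned u s t :
  unsigned u -> pshift s u = pshift t u -> pair_sign s u = pair_sign t u.
Proof.
move=> /forallP un_u e.
have /implyP/(_ _) := un_u (s * t^-1)%g.
rewrite pair_signM -pshiftM e pshiftM mulgV pshift1 eqxx => /(_ isT)/negbTE st.
have := pair_signM t^-1%g t u; rewrite mulgV pair_sign1.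
by move: st; case: (pair_sign t^-1%g _); case: (pair_sign s u); case: (pair_sign t u).
Qed.

(** The equivariant function with value 1 at u and support the orbit of u; it is
    zero when there is no such function. *)
Definition orbit_coef u v : int :=
  if unsigned u then
    if [pick s | pshift s u == v] is Some s then (-1) ^+ pair_sign s u else 0
  else 0.

Lemma orbit_coefE u s : unsigned u -> orbit_coef u (pshift s u) = (-1) ^+ pair_sign s u.
Proof.
move=> un_u; rewrite /orbit_coef un_u; case: pickP => [t /eqP e|/(_ s)].
  by rewrite (pair_sign_unsigned un_u e).
by rewrite eqxx.
Qed.

Lemma orbit_coef0 u v : (forall s, pshift s u != v) -> orbit_coef u v = 0.
Proof.
move=> uv; rewrite /orbit_coef; case: ifP => // _; case: pickP => // s.
by rewrite (negbTE (uv s)).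
Qed.

Lemma orbit_coef_equivariant u : equivariant (fun i j => orbit_coef u (i, j)).
Proof.
move=> t i j; rewrite -[(mshift t i, _)]/(pshift t (i, j)); set v := (i, j).
have [un_u|sg_u] := boolP (unsigned u); last by rewrite /orbit_coef (negbTE sg_u) mulr0.
have [/existsP[s /eqP <-]|no_s] := boolP [exists s, pshift s u == v].
  by rewrite pshiftM !orbit_coefE // pair_signM signr_addb.
rewrite !orbit_coef0 ?mulr0 // => s; apply: contra no_s => /eqP e; apply/existsP.
  by exists s; rewrite e.
by exists (s * t^-1)%g; rewrite -pshiftM e pshiftM mulgV pshift1.
Qed.

Definition orbit_rep v : mindex * mindex :=
  odflt v [pick u | [exists s, pshift s u == v]].

Lemma orbit_repP v : exists s, pshift s (orbit_rep v) = v.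
Proof.
rewrite /orbit_rep; case: pickP => [u /existsP[s /eqP]|_]; first by exists s.
by exists 1%g; rewrite pshift1.
Qed.

(** The choice made by [pick] depends only on the extent of the predicate, that
    is, on the orbit. *)
Lemma orbit_rep_shift s v : orbit_rep (pshift s v) = orbit_rep v.
Proof.
rewrite /orbit_rep (@eq_pick _ _ (fun u => [exists s, pshift s u == v])).
  case: pickP => //= /(_ v)/existsP[]; exists 1%g; by rewrite pshift1.
move=> u; apply/existsP/existsP => -[t /eqP e].
  by exists (t * s^-1)%g; rewrite -pshiftM e pshiftM mulgV pshift1.
by exists (t * s)%g; rewrite -pshiftM e.
Qed.

(** Orbits whose signs conflict contribute nothing on either side: this is where
    2 must be regular in A. *)
Lemma equivariant_decomp (A : pzRingType) (F : mindex -> mindex -> A) i j :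
    (forall x : A, x + x = 0 -> x = 0) -> equivariant F ->
  F i j = \sum_(u | orbit_rep u == u) F u.1 u.2 * (orbit_coef u (i, j))%:~R.
Proof.
move=> A2 eqF; set v := (i, j); have [s vE] := orbit_repP v.
have eqFv t w : F (pshift t w).1 (pshift t w).2 = (-1) ^+ pair_sign t w * F w.1 w.2.
  by rewrite eqF; case: w.
rewrite (bigD1 (orbit_rep v)) /=; last first.
  by rewrite -[in X in _ == X]vE orbit_rep_shift.
rewrite big1 ?addr0 => [|u /andP[/eqP uu uv]]; last first.
  rewrite orbit_coef0 ?mulr0 // => t; apply: contra uv => /eqP <-.
  by rewrite orbit_rep_shift uu.
set u := orbit_rep v in vE *.
have Fv : F i j = (-1) ^+ pair_sign s u * F u.1 u.2 by rewrite -eqFv vE.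
have [un_u|] := boolP (unsigned u).
  by rewrite Fv -vE orbit_coefE // rmorph_sign commr_sign.
case/forallPn => t; rewrite negb_imply negbK => /andP[/eqP tu sg].
have Fu0 : F u.1 u.2 = 0.
  apply: A2; have := eqFv t u; rewrite sg tu expr1 mulN1r => {1}->.
  by rewrite addNr.
by rewrite Fv Fu0 mul0r mulr0.
Qed.

Section Action.
Variable K : pzRingType.

Lemma perm_act_mulL s (X : mindex -> mindex -> K) :
  perm_act m n K s *m mxT X =
  mxT (fun i j => (-1) ^+ sign_exp s (mshift s^-1 i) * X (mshift s^-1 i) j).
Proof.
rewrite mxT_mul; apply: eq_mxT => i j.
rewrite (bigD1 (mshift s^-1%g i)) //= big1 ?addr0 => [|k kE].
  by rewrite mshiftM mulVg mshift1 eqxx.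
case: eqP => [e|_]; last by rewrite mul0r.
by move: kE; rewrite e mshiftK eqxx.
Qed.

Lemma perm_act_mulR s (X : mindex -> mindex -> K) :
  mxT X *m perm_act m n K s = mxT (fun i j => X i (mshift s j) * (-1) ^+ sign_exp s j).
Proof.
rewrite mxT_mul; apply: eq_mxT => i j.
rewrite (bigD1 (mshift s j)) //= eqxx big1 ?addr0 // => k /negbTE ->.
by rewrite mulr0.
Qed.

Lemma mxTK (X : EndV m n r K) :
  X = mxT (fun i j => X (enum_rank i) (enum_rank j)).
Proof. by apply/matrixP => a b; rewrite !mxE !enum_valK. Qed.

Lemma mxT_entry (F : mindex -> mindex -> K) i j :
  mxT F (enum_rank i) (enum_rank j) = F i j.
Proof. by rewrite mxE !enum_rankK. Qed.

Lemma equivariant_comm (X : mindex -> mindex -> K) :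
  (forall s, perm_act m n K s *m mxT X = mxT X *m perm_act m n K s) <-> equivariant X.
Proof.
split=> [cX s i j|eqX s].
  have /matrixP/(_ (enum_rank (mshift s i)) (enum_rank j)) := cX s.
  rewrite perm_act_mulL perm_act_mulR !mxT_entry mshiftK commr_sign => e.
  by rewrite /pair_sign /= addbC signr_addb !signr_odd -mulrA e signrMK.
rewrite perm_act_mulL perm_act_mulR; apply: eq_mxT => i j.
have := eqX s (mshift s^-1%g i) j.
rewrite mshiftM mulVg mshift1 => ->.
by rewrite /pair_sign /= addbC signr_addb !signr_odd -mulrA [RHS]commr_sign signrMK.
Qed.
End Action.

Definition orbit_mx u : EndV m n r int := mxT (fun i j => orbit_coef u (i, j)).

Lemma perm_act_orbit_mx s u :
  perm_act m n int s *m orbit_mx u = orbit_mx u *m perm_act m n int s.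
Proof. by move: s; apply/equivariant_comm/orbit_coef_equivariant. Qed.

(** The only link between the lattice and arbitrary coefficients: A is a
    supercommutative superalgebra when F comes from a point of GL(m|n), and the
    base field itself when F comes from a matrix commuting with S_r. *)
Lemma comm_orbit_comm_equivariant (K : fieldType) (A : algType K)
    (phi : EndV m n r K) (F : mindex -> mindex -> A) :
    2%:R != 0 :> K -> equivariant F ->
    (forall u, phi *m map_mx intr (orbit_mx u) = map_mx intr (orbit_mx u) *m phi) ->
  map_mx (in_alg A) phi *m mxT F = mxT F *m map_mx (in_alg A) phi.
Proof.
move=> two0 eqF phi_comm.
have A2 (x : A) : x + x = 0 -> x = 0.
  move=> x2; have : 2%:R^-1 *: (x + x) = 0 :> A by rewrite x2 scaler0.
  by rewrite -mulr2n -[x *+ 2](@scaler_nat K) scalerA mulVf // scale1r.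
have FE : mxT F = \sum_(u | orbit_rep u == u)
                    F u.1 u.2 *: map_mx (in_alg A) (map_mx intr (orbit_mx u)).
  apply/matrixP => a b; rewrite mxE (equivariant_decomp _ _ A2 eqF) summxE.
  by apply: eq_bigr => u _; rewrite !mxE rmorph_int.
rewrite FE mulmx_sumr mulmx_suml; apply: eq_bigr => u _.
rewrite -scalemxAl -map_mxM -phi_comm map_mxM; apply/matrixP => a b.
rewrite !mxE big_distrr /=; apply: eq_bigr => c _; rewrite !mxE mulrA.
by rewrite mulrA; congr (_ * _); rewrite /= mulr_algl mulr_algr.
Qed.

(** A multiple p^i x comes from Z S_r, and integer matrices have no torsion. *)
Lemma SigmaZ_comm_orbit_mx p (x : EndV m n r int) u : (0 < p)%N ->
  x \in @SigmaZ_pred m n r p -> x *m orbit_mx u = orbit_mx u *m x.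
Proof.
move=> p_gt0 /SigmaZ_predP[k [y xy]].
have yu : sym_act m n y *m orbit_mx u = orbit_mx u *m sym_act m n y.
  rewrite mulmx_sumr mulmx_suml; apply: eq_bigr => s _.
  by rewrite -scalemxAl -scalemxAr perm_act_orbit_mx.
have p0 : (p ^ k)%:R != 0 :> int by rewrite natz -lt0n expn_gt0 p_gt0.
move: yu; rewrite -xy -scaler_nat -scalemxAl -scalemxAr => /matrixP e.
by apply/matrixP => a b; have := e a b; rewrite mxE [RHS]mxE => /(mulfI p0).
Qed.

Lemma SigmaZ_parity p (x : EndV m n r int) a b : (0 < p)%N ->
  x \in @SigmaZ_pred m n r p ->
  mparity (enum_val a) != mparity (enum_val b) -> x a b = 0.
Proof.
move=> p_gt0 /SigmaZ_predP[k [y xy]] ab.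
have : (x *+ p ^ k) a b = 0.
  rewrite xy summxE big1 // => s _; rewrite mxE.
  (* The entry is 0 or a sign, and it vanishes over rat. *)
  have /EndGL_predP[/(_ a b ab)] := perm_act_EndGL m n rat s.
  rewrite !mxE; case: eqP => _; last by rewrite mulr0.
  by move/eqP; rewrite signr_eq0.
rewrite -scaler_nat mxE => /eqP; rewrite mulf_eq0 natz => /orP[|/eqP//].
by move=> /eqP[] /eqP; rewrite expn_eq0 -leqn0 leqNgt p_gt0.
Qed.

Lemma SigmaZ_EndGL p (x : EndV m n r int) (K : fieldType) :
    (0 < p)%N -> 2%:R != 0 :> K -> x \in @SigmaZ_pred m n r p ->
  map_mx intr x \in @EndGL_pred m n r K.
Proof.
move=> p_gt0 two0 xS; apply/EndGL_predP; split=> [a b ab|A g].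
  by rewrite mxE (SigmaZ_parity p_gt0 xS ab) rmorph0.
apply: comm_orbit_comm_equivariant => // [s i j|u]; last first.
  by rewrite -!map_mxM (SigmaZ_comm_orbit_mx u p_gt0 xS).
by rewrite gl_act_shift /pair_sign /= signr_addb !signr_odd exprD.
Qed.
End Orbits.

(** * A supercommutative algebra with square-zero generators *)

(** The algebra generated by supercommuting xi_l, l < r, of parity q l, with
    xi_l ^+ 2 = 0, given by coefficients on the monomials xi_S. *)
Definition sqz (K : fieldType) (r : nat) (q : 'I_r -> bool) : Type :=
  {ffun {set 'I_r} -> K}.

Section SquareZero.
Variables (K : fieldType) (r : nat) (q : 'I_r -> bool).
Local Notation subset := {set 'I_r}.
Implicit Types S T U W : subset.

Definition sparity U : bool := \big[addb/false]_(k in U) q k.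

(** The parity of the number of exchanges of odd generators needed to sort the
    concatenation of the monomials xi_S and xi_T. *)
Definition crossing S T : bool :=
  \big[addb/false]_(a in S) \big[addb/false]_(b in T) [&& (b < a)%N, q a & q b].

Lemma sparityU S T : [disjoint S & T] ->
  sparity (S :|: T) = sparity S (+) sparity T.
Proof.
move=> dST; rewrite /sparity -bigU //.
by apply: eq_bigl => k; rewrite !inE.
Qed.

Lemma crossingUl S T W : [disjoint S & T] ->
  crossing (S :|: T) W = crossing S W (+) crossing T W.
Proof.
move=> dST; rewrite /crossing -bigU //.
by apply: eq_bigl => k; rewrite !inE.
Qed.

Lemma crossingUr S T W : [disjoint T & W] ->
  crossing S (T :|: W) = crossing S T (+) crossing S W.
Proof.
move=> dTW; rewrite /crossing -big_split; apply: eq_bigr => a _ /=.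
by rewrite -bigU //; apply: eq_bigl => k; rewrite !inE.
Qed.

Lemma crossing0l T : crossing set0 T = false.
Proof. by rewrite /crossing big_set0. Qed.

Lemma crossing0r T : crossing T set0 = false.
Proof. by rewrite /crossing big1 // => a _; rewrite big_set0. Qed.

Lemma crossing_swap S T : [disjoint S & T] ->
  crossing S T (+) crossing T S = sparity S && sparity T.
Proof.
move=> dST; rewrite /crossing [X in _ (+) X]exchange_big -big_split /=.
rewrite /sparity big_distrl /=; apply: eq_bigr => a aS.
rewrite -big_split big_distrr /=; apply: eq_bigr => b bT.
have ab : a != b :> nat.
  by apply: contraTneq aS => /val_inj ->; rewrite (disjointFl dST bT).
by case: (ltngtP a b) ab => //= _ _; rewrite ?addbF // andbC.
Qed.

Local Notation sqz := (sqz K q).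
HB.instance Definition _ := GRing.Lmodule.copy sqz {ffun subset -> K^o}.

Definition sqz1 : sqz := [ffun U => (U == set0)%:R].
Definition sqzM (x y : sqz) : sqz :=
  [ffun U : subset => \sum_(S : subset | S \subset U)
     (-1) ^+ crossing S (U :\: S) * (x S * y (U :\: S))].

Lemma sqzMcoef (x y : sqz) U : sqzM x y U =
  \sum_(S : subset | S \subset U) (-1) ^+ crossing S (U :\: S) * (x S * y (U :\: S)).
Proof. by rewrite ffunE. Qed.

Lemma setDsub_invol S U : S \subset U -> U :\: (U :\: S) = S.
Proof. by move=> SU; rewrite setDDr setDv set0U; apply/setIidPr. Qed.

Lemma disjointDs S U : [disjoint S & U :\: S].
Proof. by rewrite disjoint_sym disjoints_subset subsetDr. Qed.

Lemma setUDsub S U : S \subset U -> S :|: (U :\: S) = U.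
Proof.
move=> SU; apply/setP => x; rewrite !inE.
by case: (boolP (x \in S)) => //= /(subsetP SU).
Qed.

Fact sqzMA : associative sqzM.
Proof.
move=> x y z; apply/ffunP => U; rewrite !sqzMcoef.
transitivity (\sum_(T : subset | T \subset U) \sum_(S : subset | S \subset T)
    (-1) ^+ (crossing T (U :\: T) (+) crossing S (T :\: S)) *
      (x S * y (T :\: S) * z (U :\: T))); last first.
  apply: eq_bigr => T TU; rewrite sqzMcoef mulr_suml mulr_sumr; apply: eq_bigr => S _.
  by rewrite signr_addb -!mulrA.
(* Both sides are sums over ordered partitions of U into S, W and R. *)
rewrite (exchange_big_dep (fun S : subset => S \subset U)) /=; last first.
  by move=> T S TU ST; apply: subset_trans TU.
apply: eq_bigr => S SU; rewrite sqzMcoef !mulr_sumr.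
rewrite [RHS](reindex_onto (fun W => S :|: W) (fun T => T :\: S)) /=; last first.
  by move=> T /andP[_ ST]; rewrite setUDsub.
have disj W : W \subset U :\: S -> [disjoint S & W].
  by rewrite subsetD disjoint_sym => /andP[].
have DUS W : W \subset U :\: S -> (S :|: W) :\: S = W.
  by move=> /disj dW; rewrite setDUl setDv set0U; apply/setDidPl; rewrite disjoint_sym.
apply: eq_big => [W|W WU].
  apply/idP/idP => [WU|/andP[/andP[SWU _] /eqP <-]]; last exact: setSD.
  rewrite DUS // eqxx subsetUl !andbT subUset SU.
  exact: subset_trans WU (subsetDl _ _).
rewrite DUS // -setDDl; set R := U :\: S :\: W.
have -> : U :\: S = W :|: R by rewrite setUDsub.
rewrite crossingUr ?disjointDs // crossingUl ?disj //.
rewrite [x S * _]mulrCA !mulrA -signr_addb -!mulrA; congr (_ ^+ (nat_of_bool _) * _).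
by rewrite -addbA addbC; congr (_ (+) _); rewrite addbC.
Qed.

Fact sqz1M : left_id sqz1 sqzM.
Proof.
move=> x; apply/ffunP => U; rewrite ffunE (bigD1 set0) ?sub0set //= big1 ?addr0.
  by rewrite ffunE eqxx setD0 crossing0l !mul1r.
by move=> S /andP[_ /negbTE S0]; rewrite ffunE S0 mul0r mulr0.
Qed.

Fact sqzM1 : right_id sqz1 sqzM.
Proof.
move=> x; apply/ffunP => U; rewrite ffunE (bigD1 U) //= big1 ?addr0.
  by rewrite ffunE setDv eqxx crossing0r mulr1 mul1r.
move=> S /andP[SU nSU]; rewrite ffunE; case: eqP => [/eqP|]; last by rewrite !mulr0.
by rewrite setD_eq0 => US; move: nSU; rewrite eqEsubset SU US.
Qed.

Fact sqzMDl : left_distributive sqzM +%R.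
Proof.
move=> x y z; apply/ffunP => U; rewrite !ffunE -big_split.
by apply: eq_bigr => S _; rewrite ffunE /= -mulrDr -mulrDl.
Qed.

Fact sqzMDr : right_distributive sqzM +%R.
Proof.
move=> x y z; apply/ffunP => U; rewrite !ffunE -big_split.
by apply: eq_bigr => S _; rewrite ffunE /= -mulrDr -mulrDr.
Qed.

Fact sqz1_neq0 : sqz1 != 0.
Proof.
by apply/eqP => /ffunP/(_ set0)/eqP; rewrite !ffunE eqxx oner_eq0.
Qed.

HB.instance Definition _ := GRing.Zmodule_isNzRing.Build sqz
  sqzMA sqz1M sqzM1 sqzMDl sqzMDr sqz1_neq0.

Fact sqz_scaleAl (a : K) (x y : sqz) : a *: (x * y) = a *: x * y.
Proof.
apply/ffunP => U; rewrite !ffunE scaler_sumr; apply: eq_bigr => S _.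
by rewrite ffunE -!mulrA [LHS]mulrCA.
Qed.
HB.instance Definition _ := GRing.Lmodule_isLalgebra.Build K sqz sqz_scaleAl.

Fact sqz_scaleAr (a : K) (x y : sqz) : a *: (x * y) = x * (a *: y).
Proof.
apply/ffunP => U; rewrite !ffunE scaler_sumr; apply: eq_bigr => S _.
by rewrite ffunE [LHS]mulrCA; congr (_ * _); rewrite mulrCA.
Qed.
HB.instance Definition _ := GRing.Lalgebra_isAlgebra.Build K sqz sqz_scaleAr.

Lemma sqzME (x y : sqz) U : (x * y) U =
  \sum_(S : subset | S \subset U) (-1) ^+ crossing S (U :\: S) * (x S * y (U :\: S)).
Proof. exact: sqzMcoef. Qed.

Lemma sqz1E U : (1 : sqz) U = (U == set0)%:R.
Proof. exact: ffunE. Qed.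

Lemma sqz_signE (c : bool) (x : sqz) U : ((-1) ^+ c * x) U = (-1) ^+ c * x U.
Proof. by case: c; rewrite ?expr0 ?mul1r // !expr1 !mulN1r ffunE. Qed.

Definition sqz_homog (e : bool) (x : sqz) : Prop :=
  forall U, sparity U != e -> x U = 0.

Fact sqz_homog0 e : sqz_homog e 0.
Proof. by move=> U _; rewrite ffunE. Qed.

Fact sqz_homog_linear e (c : K) a b :
  sqz_homog e a -> sqz_homog e b -> sqz_homog e (c *: a + b).
Proof. by move=> ha hb U Ue; rewrite !ffunE ha // hb // addr0 scaler0. Qed.

Fact sqz_homog_decomp (a : sqz) : exists! ab : sqz * sqz,
  [/\ sqz_homog false ab.1, sqz_homog true ab.2 & a = ab.1 + ab.2].
Proof.
exists ([ffun U => if sparity U then 0 else a U],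
        [ffun U => if sparity U then a U else 0]).
split=> [|[x y] [/= hx hy ->]].
  split=> [U|U|]; rewrite ?ffunE; try by case: (sparity U).
  by apply/ffunP => U; rewrite !ffunE; case: ifP; rewrite ?add0r ?addr0.
congr pair; apply/ffunP => U; rewrite !ffunE; case: ifP => sU.
- by rewrite hx ?sU.
- by rewrite (hy U) ?sU ?addr0.
- by rewrite (hx U) ?sU ?add0r.
by rewrite hy ?sU.
Qed.

Fact sqz_homog1 : sqz_homog false 1.
Proof.
move=> U; rewrite sqz1E; case: (eqVneq U set0) => // -> /negP[].
by rewrite /sparity big_set0.
Qed.

Lemma sparityD S U : S \subset U -> sparity U = sparity S (+) sparity (U :\: S).
Proof.
by move=> SU; rewrite -sparityU ?disjointDs // setUDsub.
Qed.

Fact sqz_homogM e e' a b :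
  sqz_homog e a -> sqz_homog e' b -> sqz_homog (e (+) e') (a * b).
Proof.
move=> ha hb U Ue; rewrite sqzME big1 // => S SU.
have [Se|/ha->] := eqVneq (sparity S) e; last by rewrite mul0r mulr0.
rewrite (hb (U :\: S)) ?mulr0 //; apply: contraNneq Ue => <-.
by rewrite (sparityD SU) Se.
Qed.

Fact sqz_supercomm e e' a b : sqz_homog e a -> sqz_homog e' b ->
  a * b = (-1) ^+ (e && e') * (b * a).
Proof.
move=> ha hb; apply/ffunP => U.
rewrite sqz_signE !sqzME mulr_sumr.
rewrite [RHS](reindex_onto (fun S => U :\: S) (fun S => U :\: S)) /=; last first.
  by move=> S; apply: setDsub_invol.
apply: eq_big => [S|S SU].
  rewrite subsetDl /=; apply/idP/eqP => [/setDsub_invol//|<-].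
  by rewrite subsetDl.
rewrite setDsub_invol // [b _ * _]mulrC !mulrA -signr_addb.
have [Se|/ha->] := eqVneq (sparity S) e; last by rewrite !mulr0 !mul0r.
have [Te|/hb->] := eqVneq (sparity (U :\: S)) e'; last by rewrite !mulr0.
by rewrite -Se -Te -crossing_swap ?disjointDs // addbK.
Qed.

Definition sqz_superalg : superalg K :=
  SuperAlg sqz_homog0 sqz_homog_linear sqz_homog_decomp sqz_homog1
    sqz_homogM sqz_supercomm.
End SquareZero.

Section SquareZeroGen.
Variables (K : fieldType) (r : nat) (q : 'I_r -> bool).
Local Notation subset := {set 'I_r}.
Local Notation sqz := (sqz K q).
Local Notation sqzA := (sqz_superalg K q).
Implicit Types S T U W : subset.

Lemma sqz_sumE (I : Type) (s : seq I) (P : pred I) (F : I -> sqz) U :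
  (\sum_(i <- s | P i) F i) U = \sum_(i <- s | P i) F i U.
Proof. by apply: (big_morph (fun x : sqz => x U)) => [x y|]; rewrite ffunE. Qed.

Definition sqz_basis S : sqz := [ffun U => (U == S)%:R].

Lemma sqz_basisE S U : sqz_basis S U = (U == S)%:R.
Proof. exact: ffunE. Qed.

Lemma sqz_basisM S T : [disjoint S & T] ->
  sqz_basis S * sqz_basis T = (-1) ^+ crossing q S T * sqz_basis (S :|: T).
Proof.
move=> dST; apply/ffunP => U; rewrite sqz_signE sqzME !sqz_basisE.
have [->|nU] := eqVneq U (S :|: T).
  have DS : (S :|: T) :\: S = T.
    by rewrite setDUl setDv set0U; apply/setDidPl; rewrite disjoint_sym.
  rewrite (bigD1 S) ?subsetUl //= big1 ?addr0 ?DS ?sqz_basisE ?eqxx ?mulr1 //.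
  move=> W /andP[_ WS].
  by rewrite sqz_basisE (negbTE WS) mul0r mulr0.
rewrite mulr0 big1 // => W WU; rewrite !sqz_basisE.
have [WS|_] := eqVneq W S; last by rewrite mul0r mulr0.
case: eqP => [UW|_]; last by rewrite !mulr0.
by case/eqP: nU; rewrite -UW -WS setUDsub.
Qed.

Definition xi (l : 'I_r) : sqz := sqz_basis [set l].

Lemma xi_homog l : homog (q l) (xi l : sqzA).
Proof.
move=> U; rewrite sqz_basisE; case: (eqVneq U [set l]) => // -> /negP[].
by rewrite /sparity big_set1.
Qed.

Lemma prod_xi_seq (s : seq 'I_r) : uniq s ->
  exists c : bool, \prod_(l <- s) xi l = (-1) ^+ c * sqz_basis [set l in s].
Proof.
elim: s => [|l s IH] /=.
  exists false; rewrite big_nil expr0 mul1r; apply/ffunP => U.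
  rewrite [RHS]sqz_basisE sqz1E.
  by congr (_ == _)%:R; apply/setP => k; rewrite !inE.
case/andP=> ls /IH[c sE]; rewrite big_cons sE.
exists (c (+) crossing q [set l] [set k in s]).
rewrite mulrA commr_sign -mulrA [xi l * _]sqz_basisM ?signr_addb ?mulrA.
  by congr (_ * sqz_basis _); apply/setP => k; rewrite !inE.
by rewrite disjoints1 inE.
Qed.

Lemma prod_xi_top : exists c : bool, (\prod_l xi l) setT = (-1) ^+ c.
Proof.
have [c] := prod_xi_seq (index_enum_uniq _); rewrite -/(index_enum _) => ->.
exists c; rewrite sqz_signE sqz_basisE.
suff -> : [set l in index_enum 'I_r] = setT by rewrite eqxx mulr1.
by apply/setP => l; rewrite !inE mem_index_enum.
Qed.

(** Membership in the span of the monomials without xi_l. *)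
Definition avoids (l : 'I_r) (x : sqz) : Prop := forall U, l \in U -> x U = 0.

Lemma avoids_prod l (F : 'I_r -> sqz) :
  (forall k, avoids l (F k)) -> avoids l (\prod_k F k).
Proof.
move=> hF; apply: (big_ind (avoids l)) => // [U lU|x y hx hy U lU].
  by rewrite sqz1E; case: eqP => // U0; rewrite U0 inE in lU.
rewrite sqzME big1 // => S SU.
have [lS|lS] := boolP (l \in S); first by rewrite hx // mul0r mulr0.
by rewrite hy ?mulr0 // inE lS.
Qed.

(** The powers of the ideal generated by the xi_l. *)
Definition order_ge (d : nat) (x : sqz) : Prop := forall U, (#|U| < d)%N -> x U = 0.

Lemma order_ge_sum d (I : Type) (s : seq I) (P : pred I) (F : I -> sqz) :
  (forall i, order_ge d (F i)) -> order_ge d (\sum_(i <- s | P i) F i).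
Proof.
move=> hF; apply: (big_ind (order_ge d)) => // [U _|x y hx hy U Ud].
  by rewrite ffunE.
by rewrite ffunE hx // hy // addr0.
Qed.

Lemma order_geM d e (x y : sqz) :
  order_ge d x -> order_ge e y -> order_ge (d + e) (x * y).
Proof.
move=> hx hy U Ude; rewrite sqzME big1 // => S SU.
have [dS|/hx->] := leqP d #|S|; last by rewrite mul0r mulr0.
rewrite hy ?mulr0 //; move: Ude; rewrite -(cardsID S U) (setIidPr SU).
by move=> h; rewrite -(ltn_add2l d); apply: leq_trans h; rewrite ltnS leq_add2r.
Qed.

Lemma order_ge_top x : order_ge r.+1 x -> x = 0.
Proof.
move=> hx; apply/ffunP => U; rewrite hx ?ffunE // ltnS.
by rewrite -[X in (_ <= X)%N]card_ord max_card.
Qed.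

End SquareZeroGen.

(** * A unipotent test point of the general linear supergroup *)

Lemma homog_sum (K : fieldType) (A : superalg K) e (I : Type) (s : seq I)
    (P : pred I) (F : I -> A) :
  (forall i, P i -> homog e (F i)) -> homog e (\sum_(i <- s | P i) F i).
Proof.
move=> hF; apply: (big_ind (fun x : A => homog e x)) => // [|x y hx hy].
  exact: homog0.
by rewrite -[x]scale1r; apply: homog_linear.
Qed.

Section UnipotentPoint.
Variables (m n r : nat) (K : fieldType) (u : mindex m n r * mindex m n r).

Definition letter_parity (k : 'I_r) : bool := is_odd (u.1 k) (+) is_odd (u.2 k).
Local Notation q := letter_parity.
Local Notation sqz := (sqz K q).
Local Notation A := (sqz_superalg K q).

(** The matrix \sum_l xi_l E_(i_l j_l) for u = (i, j). *)
Definition unip_nil : 'M[sqz]_(m + n) :=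
  \matrix_(i, j) \sum_l xi K q l *+ ((i, j) == (u.1 l, u.2 l)).
Local Notation N := unip_nil.

Lemma unip_nilX d i j : order_ge d ((N ^+ d) i j).
Proof.
elim: d i j => [|d IH] i j; first by move=> U.
rewrite exprSr mxE -addn1; apply: order_ge_sum => l.
apply: order_geM (IH _ _) _ => U; rewrite ltnS leqn0 cards_eq0 => /eqP->.
rewrite mxE sqz_sumE big1 // => k _; case: (_ == _); last by rewrite mulr0n ffunE.
by rewrite mulr1n /xi sqz_basisE eq_sym -cards_eq0 cards1.
Qed.

Lemma unip_nil0 : N ^+ r.+1 = 0.
Proof. by apply/matrixP => i j; rewrite [RHS]mxE; apply/order_ge_top/unip_nilX. Qed.

Definition unip_inv : 'M[sqz]_(m + n) := \sum_(i < r.+1) (- N) ^+ i.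

Lemma unip_invr : (1 + N) * unip_inv = 1.
Proof.
have := subrX1 (- N) r.+1; rewrite exprNn unip_nil0 mulr0 sub0r -opprD addrC mulNr.
by move/oppr_inj.
Qed.

Lemma unip_invl : unip_inv * (1 + N) = 1.
Proof.
rewrite -[RHS]unip_invr; apply/esym/commr_sum => i _; apply/commrX.
by apply/commrN/commr_sym/commrD; [exact: commr1|].
Qed.

Definition unip_fun (v : VA m n A) : VA m n A := (1 + N) *m v.

Fact unip_add v w : unip_fun (v + w) = unip_fun v + unip_fun w.
Proof. exact: mulmxDr. Qed.
Fact unip_scale v (a : A) : unip_fun (v *m a%:M) = unip_fun v *m a%:M.
Proof. exact: mulmxA. Qed.
Fact unip_parity e v : homog_vec e v -> homog_vec e (unip_fun v).
Proof.
move=> hv i; rewrite mxE; apply: homog_sum => j _.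
have -> : e (+) is_odd i = (is_odd i (+) is_odd j) (+) (e (+) is_odd j).
  by rewrite addbACA addbb addbF addbC.
apply: homogM; last exact: hv.
rewrite !mxE -[in X in homog _ X](scale1r (_ *+ _)).
apply: (@homog_linear _ A).
  case: eqP => [->|_]; last exact: (@homog0 _ A).
  by rewrite addbb; apply: (@homog1 _ A).
apply: (@homog_sum _ A) => l _; case: eqP => [[-> ->]|_]; last exact: (@homog0 _ A).
exact: xi_homog.
Qed.
Fact unip_bij : bijective unip_fun.
Proof.
exists (mulmx unip_inv) => v; rewrite /unip_fun mulmxA.
  by rewrite -[unip_inv *m _]/(unip_inv * _) unip_invl mul1mx.
by rewrite -[_ *m unip_inv]/(_ * unip_inv) unip_invr mul1mx.
Qed.

Definition unip : GLpoint m n A :=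
  Build_GLpoint unip_add unip_scale unip_parity unip_bij.

(** The summands of an entry of the test point: [None] stands for the identity
    matrix and [Some l] for the generator xi_l. *)
Definition unip_factor (v : mindex m n r * mindex m n r) (k : 'I_r)
    (o : option 'I_r) : sqz :=
  if o is Some l then xi K q l *+ ((v.1 k, v.2 k) == (u.1 l, u.2 l))
  else (v.1 k == v.2 k)%:R.

Lemma unip_entry (v : mindex m n r * mindex m n r) k :
  unip (base_vec A (v.2 k)) (v.1 k) 0 = \sum_o unip_factor v k o.
Proof.
rewrite /= /unip_fun /base_vec -colE mxE [LHS]mxE !mxE (bigD1 None) //=; congr (_ + _).
rewrite (reindex_omap Some id) //=; last by case.
by apply: eq_big => l //; rewrite eqxx.
Qed.

Lemma unip_factor_avoids v k o l : o != Some l -> avoids l (unip_factor v k o).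
Proof.
case: o => [l'|] /= neq U lU.
  case: (_ == _); last by rewrite mulr0n ffunE.
  rewrite mulr1n sqz_basisE; case: eqP => // Ul; move: lU neq.
  by rewrite Ul inE => /eqP->; rewrite eqxx.
case: (_ == _); last by rewrite ffunE.
by rewrite sqz1E; case: eqP => // U0; rewrite U0 inE in lU.
Qed.

(** A product of r summands reaches the top monomial only if each generator
    occurs once; the summands then match the letters of v with those of u
    through a permutation. *)
Lemma unip_factor_prod (v : mindex m n r * mindex m n r)
    (f : {ffun 'I_r -> option 'I_r}) :
  (\prod_k unip_factor v k (f k)) setT = 0 \/
  exists2 s : 'S_r, pshift s u = v &
    \prod_k unip_factor v k (f k) = \prod_k xi K q ((s^-1)%g k).
Proof.
have [/existsP[l /forallP fl]|/existsPn f_surj] :=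
  boolP [exists l, [forall k, f k != Some l]].
  left; apply: (@avoids_prod _ _ _ l) (in_setT l) => k.
  exact: unip_factor_avoids.
have /fin_all_exists[h fh] : forall l, exists k, f k = Some l.
  move=> l; have /forallPn[k] := f_surj l; rewrite negbK => /eqP fk.
  by exists k.
have h_inj : injective h by move=> l l' e; apply: Some_inj; rewrite -!fh e.
pose s := perm h_inj.
have fE k : f k = Some ((s^-1)%g k) by rewrite -fh -[h _](permE h_inj) -/s permKV.
pose b k : bool := (v.1 k, v.2 k) == (u.1 ((s^-1)%g k), u.2 ((s^-1)%g k)).
have prodE : \prod_k unip_factor v k (f k) =
    \prod_k xi K q ((s^-1)%g k) *+ \prod_k b k.
  by rewrite -prodrMn; apply: eq_bigr => k _; rewrite fE.
have [/forallP all_b|/forallPn[k /negbTE bk]] := boolP [forall k, b k].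
  right; exists s.
    rewrite [RHS]surjective_pairing /pshift.
    by congr pair; apply/ffunP => k; rewrite ffunE; have /eqP[e1 e2] := all_b k.
  by rewrite prodE [X in _ *+ X]big1 // => k _; rewrite all_b.
by left; rewrite prodE (bigD1 k) //= bk mul0n mulr0n ffunE.
Qed.

(** The coefficient of the product of all generators in an entry of the action of
    the test point on the tensor power. *)
Definition unip_top (i j : mindex m n r) : K :=
  pure_tensor (fun k => is_odd (j k)) (fun k => unip (base_vec A (j k))) i setT.

Lemma unip_topE v : exists c : bool, unip_top v.1 v.2 =
  (-1) ^+ c * \sum_(f : {ffun 'I_r -> option 'I_r}) (\prod_k unip_factor v k (f k)) setT.
Proof.
rewrite /unip_top /pure_tensor -signr_odd; set c := odd _; exists c.
rewrite sqz_signE; congr (_ * _).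
under eq_bigr => k _ do rewrite unip_entry.
by rewrite bigA_distr_bigA sqz_sumE.
Qed.

Lemma unip_top_orbit v : unip_top v.1 v.2 != 0 -> exists s, pshift s u = v.
Proof.
have [c ->] := unip_topE v; apply: contraNP => no_s.
rewrite big1 ?mulr0 // => f _.
by have [//|[s us _]] := unip_factor_prod v f; case: no_s; exists s.
Qed.

Lemma unip_top_equivariant : equivariant unip_top.
Proof.
move=> s i j.
have /(congr1 (fun x : sqz => x setT)) := gl_act_shift unip s i j.
rewrite -signr_odd oddD sqz_signE; exact.
Qed.

(** Modulo 2, the mixed terms a k b l + a l b k sum to zero over the inversions of
    s: they measure how the sum of (a k + b k) b l over k < l changes under
    reindexing by s, and this sum is unchanged because a and b are invariant. *)
Lemma sgnX_xor_invariant (s : 'S_r) (a b : 'I_r -> bool) :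
  (forall k, a ((s^-1)%g k) = a k) -> (forall k, b ((s^-1)%g k) = b k) ->
  sgnX s (fun k => a k (+) b k) = sgnX s a (+) sgnX s b.
Proof.
move=> sa sb.
have := pairs_reindex s (fun k l => (a k (+) b k) && b l).
under eq_bigr => kl _ do rewrite sa !sb.
pose X := \big[addb/false]_(kl : 'I_r * 'I_r | (kl.1 < kl.2)%N)
            ((a kl.1 (+) b kl.1) && b kl.2).
move=> /(congr1 (addb X)); rewrite addbb -big_split /= => e0.
apply: (etrans _ (congr1 (addb^~ (sgnX s a (+) sgnX s b)) (esym e0))).
rewrite /= /sgnX -!big_split /=.
apply: eq_bigr => -[k l] /= kl.
have nst : s k != s l :> nat.
  by apply: contraTneq kl => /val_inj/perm_inj->; rewrite ltnn.
case: (ltngtP (s k) (s l)) nst => //= _ _;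
  by case: (a k); case: (b k); case: (a l); case: (b l).
Qed.

(** A permutation fixing u exchanges generators of equal letters; when u is
    [unsigned] the odd ones among these exchanges cancel. *)
Lemma prod_xi_stab (s : 'S_r) : unsigned u -> pshift s u = u ->
  \prod_k xi K q ((s^-1)%g k) = \prod_k xi K q k.
Proof.
move=> un_u su.
have s_inv (w : mindex m n r) : mshift s w = w -> forall k, w ((s^-1)%g k) = w k.
  by move=> sw k; rewrite -[in RHS]sw ffunE.
have su1 : mshift s u.1 = u.1 by rewrite -[in RHS]su.
have su2 : mshift s u.2 = u.2 by rewrite -[in RHS]su.
have sE : sgnX s q = pair_sign s u.
  rewrite /pair_sign !odd_sign_exp -sgnX_xor_invariant // => k.
    by rewrite s_inv.
  by rewrite s_inv.
rewrite (prod_reorder (A := A) s (@xi_homog K r q)) sE.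
rewrite (pair_sign_unsigned (t := 1%g) un_u) ?pshift1 //.
by rewrite pair_sign1 mul1r.
Qed.

(** All nonzero terms of the expansion have the same sign, so that up to sign the
    coefficient is the number of these terms, and the term pairing k with xi_k
    is one of them. This number may be divisible by a prime p. *)
Lemma unip_top_neq0 : [pchar K] =i pred0 -> unsigned u -> unip_top u.1 u.2 != 0.
Proof.
move=> /pcharf0P char0 un_u.
have [c ->] := unip_topE u; rewrite mulf_eq0 signr_eq0 /=.
have [t tE] := prod_xi_top K q.
pose val f := (\prod_k unip_factor u k (f k)) setT.
rewrite (eq_bigr (fun f : {ffun 'I_r -> option 'I_r} =>
  (-1) ^+ t * (val f != 0)%:R)) => [|f _].
  rewrite -mulr_sumr mulf_eq0 signr_eq0 /= -natr_sum char0 sum_nat_eq0.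
  apply/forallPn; exists [ffun k => Some k].
  suff -> : val [ffun k => Some k] != 0 by [].
  rewrite /val (eq_bigr (xi K q)) => [|k _]; first by rewrite tE signr_eq0.
  by rewrite ffunE /= eqxx.
rewrite /val; have [->|[s su ->]] := unip_factor_prod u f.
  by rewrite eqxx mulr0.
by rewrite prod_xi_stab // tE signr_eq0 mulr1.
Qed.

(** The entries of phi are scalars, so commutation holds coefficient by
    coefficient, without signs, even when the orbit of u is odd. *)
Lemma EndGL_comm_unip_top (phi : EndV m n r K) : phi \in @EndGL_pred m n r K ->
  phi *m mxT unip_top = mxT unip_top *m phi.
Proof.
case/EndGL_predP => _ /(_ A unip)/matrixP phi_comm.
apply/matrixP => a b.
have := phi_comm a b; rewrite mxE [RHS]mxE => /(congr1 (fun x : sqz => x setT)).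
rewrite !sqz_sumE => e; rewrite mxE [RHS]mxE.
transitivity (\sum_c ((map_mx (in_alg A) phi) a c * gl_act r unip c b : sqz) setT).
  by apply: eq_bigr => c _; rewrite !mxE /= mulr_algl ffunE.
by rewrite e; apply: eq_bigr => c _; rewrite !mxE /= mulr_algr ffunE mulrC.
Qed.

(** The matrix of top coefficients is equivariant and supported on the orbit of
    u, hence a multiple of the orbit matrix. *)
Lemma EndGL_comm_orbit_mx (phi : EndV m n r K) : [pchar K] =i pred0 ->
  phi \in @EndGL_pred m n r K ->
  phi *m map_mx intr (orbit_mx u) = map_mx intr (orbit_mx u) *m phi.
Proof.
move=> char0 phiE.
have [un_u|sg_u] := boolP (unsigned u); last first.
  have -> : orbit_mx u = 0.
    by apply/matrixP => a b; rewrite !mxE /orbit_coef (negbTE sg_u).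
  by rewrite raddf0 mulmx0 mul0mx.
have topE : mxT unip_top = unip_top u.1 u.2 *: map_mx intr (orbit_mx u).
  apply/matrixP => a b; rewrite !mxE; set i := enum_val a; set j := enum_val b.
  have [top0|/(@unip_top_orbit (i, j))[s us]] := eqVneq (unip_top i j) 0.
    rewrite top0 orbit_coef0 ?mulr0 // => s; apply: contra_eqN top0 => /eqP us.
    have [-> ->] : i = mshift s u.1 /\ j = mshift s u.2 by case: us.
    by rewrite unip_top_equivariant mulf_neq0 ?signr_eq0 ?unip_top_neq0.
  rewrite -us orbit_coefE // rmorph_sign.
  have [-> ->] : i = mshift s u.1 /\ j = mshift s u.2 by case: us.
  by rewrite unip_top_equivariant -surjective_pairing mulrC.
have := EndGL_comm_unip_top phiE.
rewrite topE -scalemxAr -scalemxAl => /(scalerI _); apply.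
exact: unip_top_neq0.
Qed.
End UnipotentPoint.

(** * A basis of the saturated lattice *)

Section Sigma.
Variables (m n r p : nat).
Hypothesis p_pr : prime p.
Local Notation SigmaZ_pred := (@SigmaZ_pred m n r p).

Lemma map_perm_act (K : pzRingType) (s : 'S_r) :
  map_mx intr (perm_act m n int s) = perm_act m n K s.
Proof.
apply/matrixP => a b; rewrite !mxE; case: eqP => _; last by rewrite rmorph0.
by rewrite rmorph_sign.
Qed.

(** Matrices are flattened to rows, so that the image of Z S_r becomes the row
    lattice of the matrix whose rows are the permutation matrices. *)
Lemma SigmaZ_basis : exists (d : nat) (b : 'I_d -> SigmaZ m n r p),
  (forall x : SigmaZ m n r p, exists c : 'I_d -> int, x = \sum_j b j *~ c j) /\
  (forall F : fieldType, [pchar F] =i pred0 \/ p \in [pchar F] ->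
     forall c : 'I_d -> F, \sum_j c j *: map_mx intr (SigmaZ_val (b j)) = 0 ->
     forall j, c j = 0).
Proof.
pose G := \matrix_(a < #|'S_r|) mxvec (perm_act m n int (enum_val a)).
have [d [B [BP Bfree]]] := saturated_basis G p_pr.
have GE (y : galg int r) : mxvec (sym_act m n y) = \row_a y (enum_val a) *m G.
  rewrite mulmx_sum_row /sym_act /galg_lift linear_sum [LHS]big_enum_val /=.
  by apply: eq_bigr => a _; rewrite linearZ mxE rowK.
have SigmaZE x : x \in SigmaZ_pred <-> exists c : 'rV_d, mxvec x = c *m B.
  rewrite -BP; split.
    case/SigmaZ_predP=> i [y xy]; exists i, (\row_a y (enum_val a)).
    by rewrite -GE -xy raddfMn.
  case=> i [u xu]; apply/SigmaZ_predP; exists i, [ffun s => u 0 (enum_rank s)].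
  apply: (can_inj mxvecK); rewrite GE raddfMn xu; congr (_ *m _).
  by apply/rowP => a; rewrite mxE ffunE enum_valK.
have bP j : vec_mx (row j B) \in SigmaZ_pred.
  by apply/SigmaZE; exists (delta_mx 0 j); rewrite vec_mxK rowE.
exists d, (fun j => MkSigmaZ (bP j)); split=> [x|F charF c c0 j].
  have /SigmaZE[c xE] := valP x.
  exists (fun j => c 0 j); apply: val_inj; apply: (can_inj mxvecK).
  rewrite [mxvec (val x)]xE mulmx_sum_row raddf_sum linear_sum; apply: eq_bigr => j _.
  by rewrite !raddfMz /= vec_mxK -scaler_int intz.
have /row_freeP[B' BB'] := Bfree F charF.
suff : \row_j c j *m map_mx intr B = 0.
  move=> /(congr1 (mulmx^~ B')); rewrite -mulmxA BB' mulmx1 mul0mx.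
  by move=> /rowP/(_ j); rewrite !mxE.
move: c0 => /(congr1 mxvec); rewrite linear_sum linear0 => <-.
rewrite mulmx_sum_row; apply: eq_bigr => i _.
by rewrite mxE linearZ /= -map_mxvec vec_mxK map_row.
Qed.
End Sigma.

(** * Schur-Weyl duality in characteristic zero *)

Lemma sym_act_delta m n r (K : comNzRingType) (s : 'S_r) :
  sym_act m n (galg_delta K s) = perm_act m n K s.
Proof.
rewrite /sym_act /galg_lift (bigD1 s) //= ffunE eqxx scale1r big1 ?addr0 //.
by move=> t /negbTE ts; rewrite ffunE ts scale0r.
Qed.

Section CharZero.
Variables (m n r : nat) (F : fieldType).
Hypothesis char0 : [pchar F] =i pred0.

(** A matrix commuting with S_r is a combination of orbit matrices, with which phi
    commutes; so phi is in the double centralizer of S_r. *)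
Lemma super_schur_weyl (phi : EndV m n r F) : phi \in @EndGL_pred m n r F ->
  exists c : 'S_r -> F, phi = \sum_s c s *: perm_act m n F s.
Proof.
move=> phiE; have /pcharf0P natF0 := char0.
have phi_comm (M : EndV m n r F) :
    (forall s, perm_act m n F s *m M = M *m perm_act m n F s) -> phi *m M = M *m phi.
  rewrite (mxTK M) => cM; have /equivariant_comm eqM := cM.
  have in_algE : map_mx (in_alg F^o) phi = phi.
    by apply/matrixP => a b; rewrite !mxE /= [_%:A]mulr1.
  rewrite -{1 2}in_algE.
  apply: (comm_orbit_comm_equivariant (A := F^o)) => // [|u]; first by rewrite natF0.
  exact: EndGL_comm_orbit_mx.
(* [perm_act] reverses products; the inverse makes P a representation. *)
pose P (s : 'S_r) := perm_act m n F s^-1%g.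
have P1 : P 1%g = 1%:M by rewrite /P invg1 perm_act1.
have PM s t : P (s * t)%g = P s *m P t by rewrite /P perm_actM invMg.
have card0 : #|'S_r|%:R != 0 :> F by rewrite natF0 -lt0n -cardsT cardG_gt0.
have [|c phiP] := double_centralizer P1 PM card0 (phi := phi).
  by move=> M cM; apply: phi_comm => s; have := cM s^-1%g; rewrite /P invgK.
exists (fun s => c s^-1%g); rewrite phiP (reindex_inj invg_inj) /=.
by apply: eq_bigr => s _; rewrite /P invgK.
Qed.

Lemma perm_act_SigmaZ p s : perm_act m n int s \in @SigmaZ_pred m n r p.
Proof. by rewrite -sym_act_delta sym_act_SigmaZ. Qed.

(** A Z-basis of the lattice is a basis of the centralizer over F: its members lie
    in the centralizer, and the permutation matrices are integer combinations
    of them. *)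
Lemma has_dim_EndGL p d (b : 'I_d -> SigmaZ m n r p) : (0 < p)%N ->
  (forall x : SigmaZ m n r p, exists c : 'I_d -> int, x = \sum_j b j *~ c j) ->
  (forall c : 'I_d -> F, \sum_j c j *: map_mx intr (SigmaZ_val (b j)) = 0 ->
     forall j, c j = 0) ->
  has_dim (EndGL m n r F) d.
Proof.
move=> p_gt0 spanb freeb.
have two0 : 2%:R != 0 :> F by have /pcharf0P-> := char0.
exists (fun j => MkEndGL (SigmaZ_EndGL p_gt0 two0 (valP (b j)))).
apply: is_basisP => [phi|c /(congr1 val)]; last first.
  by rewrite raddf_sum => c0; apply: freeb.
have [c phiE] := super_schur_weyl (valP phi).
have /fin_all_exists[z zE] : forall s, exists z : 'I_d -> int,
    MkSigmaZ (perm_act_SigmaZ p s) = \sum_j b j *~ z j by move=> s; apply: spanb.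
exists (fun j => \sum_s c s * (z s j)%:~R); apply: val_inj.
rewrite raddf_sum [LHS]phiE /=.
under [RHS]eq_bigr => j _ do rewrite scaler_suml.
rewrite exchange_big; apply: eq_bigr => s _ /=.
have /(congr1 (fun x : SigmaZ m n r p =>
  map_mx intr (val x) : EndV m n r F)) := zE s.
rewrite [LHS]map_perm_act => ->.
rewrite raddf_sum raddf_sum scaler_sumr; apply: eq_bigr => j _.
by rewrite !raddfMz -scaler_int scalerA mulrC.
Qed.
End CharZero.

(** * Reduction of the lattice to the field *)

Section Reduction.
Variables (m n r p : nat) (K : fieldType).
Hypotheses (p_gt0 : (0 < p)%N) (two0 : 2%:R != 0 :> K).
Local Notation SigmaK := (Sigma m n r p K).

Definition reduce (a : K) (x : SigmaZ m n r p) : EndV m n r K :=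
  a *: map_mx intr (SigmaZ_val x).

Lemma reduce_biadditive : biadditive reduce.
Proof.
split=> [a a' x|a x x']; first exact: scalerDl.
by rewrite /reduce -scalerDr -raddfD.
Qed.

Fact reduce_EndGL (x : SigmaK) : tens_lift reduce x \in @EndGL_pred m n r K.
Proof. by apply: rpred_sum => u _; apply/rpredZ/(SigmaZ_EndGL p_gt0 two0)/valP. Qed.

Definition Phi_tilde_of (x : SigmaK) : EndGL m n r K := MkEndGL (reduce_EndGL x).

Fact Phi_tilde_zmod : zmod_morphism Phi_tilde_of.
Proof.
move=> x y; apply: val_inj; have hb := reduce_biadditive.
by rewrite /= (tens_liftD hb) (tens_liftN hb).
Qed.

Fact Phi_tilde_monoid : monoid_morphism Phi_tilde_of.
Proof.
have hb := reduce_biadditive.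
split=> [|x y]; apply: val_inj => /=.
  by rewrite (tens_lift_tens hb) /reduce scale1r map_mx1.
rewrite (tens_liftM _ _ hb) /tens_lift /tens_eval mulr_suml.
apply: eq_bigr => u _; rewrite mulr_sumr; apply: eq_bigr => v _.
by rewrite /reduce -[RHS]/(_ *m _) -scalemxAl -scalemxAr scalerA -map_mxM.
Qed.

HB.instance Definition _ := GRing.isZmodMorphism.Build SigmaK (EndGL m n r K)
  Phi_tilde_of Phi_tilde_zmod.
HB.instance Definition _ := GRing.isMonoidMorphism.Build SigmaK (EndGL m n r K)
  Phi_tilde_of Phi_tilde_monoid.

Fact Phi_tilde_scalable : scalable Phi_tilde_of.
Proof.
move=> c x; apply: val_inj; have hb := reduce_biadditive.
rewrite /= (tens_liftZ hb c x) /tens_lift /tens_eval scaler_sumr.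
by apply: eq_bigr => u _; rewrite /reduce scalerA.
Qed.
HB.instance Definition _ := GRing.isScalable.Build K SigmaK (EndGL m n r K) *:%R
  Phi_tilde_of Phi_tilde_scalable.

Lemma Phi_tilde_tens a x :
  EndGL_val (Phi_tilde_of (tens a x)) = a *: map_mx intr (SigmaZ_val x).
Proof. exact: (tens_lift_tens reduce_biadditive). Qed.

Lemma Phi_tilde_f_Sigma y : Phi_tilde_of (f_Sigma m n p y) = Phi m n y.
Proof.
rewrite raddf_sum; apply: eq_bigr => s _; apply: val_inj.
rewrite [LHS]Phi_tilde_tens /=; congr (_ *: _).
by rewrite -map_perm_act sym_act_delta.
Qed.

Section Basis.
Variables (d : nat) (b : 'I_d -> SigmaZ m n r p).
Hypothesis spanb :
  forall x : SigmaZ m n r p, exists c : 'I_d -> int, x = \sum_j b j *~ c j.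
Hypothesis freeb : forall c : 'I_d -> K,
  \sum_j c j *: map_mx intr (SigmaZ_val (b j)) = 0 -> forall j, c j = 0.

Lemma tens_span (x : SigmaK) : exists c : 'I_d -> K, x = \sum_j c j *: tens 1 (b j).
Proof.
rewrite [x]tensE; apply: (big_ind (fun x : SigmaK =>
  exists c : 'I_d -> K, x = \sum_j c j *: tens 1 (b j))).
- by exists (fun=> 0); rewrite big1 // => j _; rewrite scale0r.
- move=> _ _ [c ->] [c' ->]; exists (fun j => c j + c' j).
  by rewrite -big_split; apply: eq_bigr => j _; rewrite scalerDl.
move=> [a y] _ /=; have [c ->] := spanb y.
exists (fun j => a * (c j)%:~R).
have hb := tens_biadditive K (SigmaZ m n r p).
have tens_zmod : zmod_morphism (@tens K (SigmaZ m n r p) a).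
  by move=> x1 x2; rewrite -[in RHS](subrK x2 x1) (hb.2 a (x1 - x2)) addrK.
pose f : {additive SigmaZ m n r p -> SigmaK} := HB.pack (@tens K (SigmaZ m n r p) a)
  (GRing.isZmodMorphism.Build (SigmaZ m n r p) SigmaK _ tens_zmod).
rewrite -[LHS]/(f _) raddf_sum; apply: eq_bigr => j _.
by rewrite raddfMz -scaler_int /f /= !scale_tens mulr1 mulrC.
Qed.

Lemma Phi_tilde_comb (c : 'I_d -> K) :
  EndGL_val (Phi_tilde_of (\sum_j c j *: tens 1 (b j))) =
  \sum_j c j *: map_mx intr (SigmaZ_val (b j)).
Proof.
rewrite linear_sum -[LHS]/(\val _) raddf_sum; apply: eq_bigr => j _.
by rewrite linearZ -[RHS]/(c j *: _) -[X in _ = _ *: X]scale1r -Phi_tilde_tens.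
Qed.

Lemma Phi_tilde_inj : injective Phi_tilde_of.
Proof.
apply: raddf_inj => x; have [c ->] := tens_span x.
move/(congr1 (@EndGL_val m n r K)); rewrite Phi_tilde_comb => c0.
by rewrite big1 // => j _; rewrite (freeb c0) scale0r.
Qed.

Lemma has_dim_Sigma : has_dim SigmaK d.
Proof.
exists (fun j => tens 1 (b j)); apply: is_basisP => [x|c c0]; first exact: tens_span.
by apply: freeb; rewrite -Phi_tilde_comb c0 raddf0.
Qed.
End Basis.
End Reduction.

(** * Comparison *)

Theorem theorem4 (k : fieldType) (p : nat) (p_char : p \in [pchar k])
    (p_gt2 : (2 < p)%N) (R : realType) (m n r : nat) (r_gt0 : (0 < r)%N) :
  (exists d : nat,
     has_dim (Sigma m n r p k) d /\ has_dim (EndGL m n r R[i]) d) /\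
  (exists Phi_tilde : {rmorphism Sigma m n r p k -> EndGL m n r k},
     [/\ scalable Phi_tilde,
         forall (a : k) (x : SigmaZ m n r p),
           EndGL_val (Phi_tilde (tens a x)) = a *: map_mx intr (SigmaZ_val x),
         injective Phi_tilde,
         forall y : galg k r, Phi_tilde (f_Sigma m n p y) = Phi m n y
       & bijective Phi_tilde <->
         exists d : nat,
           has_dim (EndGL m n r k) d /\ has_dim (EndGL m n r R[i]) d]).
Proof.
have p_pr : prime p by have /andP[] := p_char.
have p_gt0 := prime_gt0 p_pr.
have two0 : 2%:R != 0 :> k by rewrite -(dvdn_pcharf p_char) gtnNdvd.
have charC : [pchar R[i]] =i pred0 by exact: Num.Theory.pchar_num.
have [d [b [spanb freeb]]] := SigmaZ_basis m n r p_pr.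
have freeb_k := freeb k (or_intror p_char).
have dimS := has_dim_Sigma p_gt0 two0 spanb freeb_k.
have dimC := has_dim_EndGL charC p_gt0 spanb (freeb R[i] (or_introl charC)).
have inj : injective (@Phi_tilde_of m n r p k p_gt0 two0).
  exact: Phi_tilde_inj spanb freeb_k.
split; first by exists d.
exists (@Phi_tilde_of m n r p k p_gt0 two0); split=> //.
- exact: Phi_tilde_scalable.
- exact: Phi_tilde_tens.
- exact: Phi_tilde_f_Sigma.
rewrite (bijective_dim (f := @Phi_tilde_of m n r p k p_gt0 two0) inj dimS).
split=> [dimk|[d' [dimk dimC']]]; first by exists d.
by rewrite (has_dim_uniq dimC dimC').
Qed.
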